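(* Let $\alpha\in\mathbb C$ be generic, i.e. $\frac{\alpha\ln q}{2\pi i}\notin\mathbb Q$. For $m\in\mathbb N$ consider the equation $$\frac{dL}{dt}=\left[(L^{m/\alpha})_{(+)},L\right],\qquad L\in\widehat G_\alpha. \qquad( * )$$ Then: 1. The equation $( * )$ is self-consistent, i.e. its right-hand side is well-defined and belongs to the tangent space $T_L\widehat G_\alpha$. 2. The flows of $( * )$ corresponding to different values of $m$ commute with each other. 3. The functionals $H_k=\frac{\alpha}{k}\operatorname{Tr}L^{k/\alpha}$, $k\in\mathbb N$, are conservation laws for $( * )$.
   Context: Fix $q\in\mathbb C$, $0<|q|<1$, with the branch $\ln q$ chosen by $-\pi<\arg q<\pi$, $\ln1=0$; $q^\alpha=e^{\alpha\ln q}$. $\mathbb C((z^{-1}))$ is the field of formal series $\sum_{i\le N}a_iz^i$; $(\hat h^\alpha f)(z)=f(q^\alpha z)$ for $\alpha\in\mathbb C$. $\Psi\mathbf D_q$ is the algebra of formal series $A=\sum_{i=-\infty}^{N}a_iD^i$, $a_i\in\mathbb C((z^{-1}))$, $D a=(\hat ha)D$; $A_{(+)}$ is the part of $A$ with nonnegative powers of $D$, and $J_-$ is the subspace of series with only negative powers of $D$; $\operatorname{Tr}A$ is the coefficient of $z^0$ in $a_0$. A normalized q-pseudodifference symbol of degree $\alpha$ is a formal series $L=D^\alpha+\sum_{i\ge1}a_iD^{\alpha-i}$, $a_i\in\mathbb C((z^{-1}))$; symbols (including non-normalized ones) are multiplied by the rule $D^\alpha\circ a=(\hat h^\alpha a)\circ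 D^\alpha$. $\widehat G_\alpha$ is the set of normalized symbols of degree $\alpha$; $\widehat G_-=\bigcup_\alpha\widehat G_\alpha$ is a group. $T_L\widehat G_\alpha=\{\overline X D^\alpha:\overline X\in J_-\}$, i.e. series $\sum_{i\ge1}b_iD^{\alpha-i}$. $\sigma_\beta(X)=D^\beta XD^{-\beta}$. Complex powers: for $X\in J_-$ let $\exp t(X+\ln D)=A(t)D^t$, where $A(t)\in\widehat G_0$ is the unique solution of $\frac{dA}{dt}=A\,\sigma_t(X)$, $A(0)=1$, $t\in\mathbb C$ (coefficientwise). For generic $\alpha$ every $L\in\widehat G_\alpha$ is uniquely $L=\exp\alpha(X+\ln D)$ with $X\in J_-$, and $L^\beta:=\exp\alpha\beta(X+\ln D)\in\widehat G_{\alpha\beta}$. In particular $L^{m/\alpha}\in\widehat G_m\subset\Psi\mathbf D_q$ for $m\in\mathbb N$. Commuting of flows is understood formally: $\frac{d^2L}{dt\,d\tau}=\frac{d^2L}{d\tau\,dt}$ for the evolutions with times $t,\tau$. *)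

(* Defs.v *)
From HB Require Import structures.
From mathcomp Require Import all_boot all_order all_algebra.
From mathcomp Require Import complex.
From mathcomp Require Import all_classical all_reals all_analysis.

Set Implicit Arguments.
Unset Strict Implicit.
Unset Printing Implicit Defensive.

Import Order.TTheory GRing.Theory Num.Theory numFieldNormedType.Exports.
Local Open Scope classical_set_scope.
Local Open Scope ring_scope.
Local Open Scope complex_scope.

Definition cexp (R : realType) (z : R[i]) : R[i] :=
  (expR (complex.Re z) * cos (complex.Im z))
    +i* (expR (complex.Re z) * sin (complex.Im z)).

(* The branch excludes negative real q, as the strict inequalities
   -pi < arg q < pi do. *)
Definition is_log_branch (R : realType) (q l : R[i]) : Prop :=
  cexp l = q /\ - pi < complex.Im l < pi.

Section Symbols.
Context {R : realType}.
Variable lnq : R[i].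
Local Notation C := R[i].

Definition qpow (a : C) : C := cexp (a * lnq).

Definition generic (a : C) : Prop :=
  forall r : rat, a * lnq / (2 * pi%:C * 'i) <> ratr r.

(* [f n] is the coefficient of z^n. *)
Definition laurent : Type := int -> C.

Definition is_laurent (f : laurent) : Prop :=
  exists N : int, forall n, N < n -> f n = 0.

(* For f, g satisfying [is_laurent] the sum has finite support; the library's
   finitely supported sum returns 0 on infinite supports. *)
Definition lmul (f g : laurent) : laurent :=
  fun n => \sum_(i \in [set: int]) f i * g (n - i).

(* f(z) |-> f(q^a z) *)
Definition hhat (a : C) (f : laurent) : laurent := fun n => qpow a ^ n * f n.

(* [A g] is the coefficient of D^g, for an arbitrary complex exponent g.  Thus
   symbols of all degrees, and PsiD_q (exponents in Z), live in one type, with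
   one product.  The support conditions are imposed by the predicates below. *)
Definition symbol : Type := C -> laurent.

Definition symb0 : symbol := fun _ _ => 0.

Definition Dpow (a : C) : symbol := fun g n => ((g == a) && (n == 0))%:R.

Definition sadd (A B : symbol) : symbol := fun g n => A g n + B g n.

Definition sopp (A : symbol) : symbol := fun g n => - A g n.

(* (a D^b) (c D^d) = a (hhat b c) D^(b + d) *)
Definition smul (A B : symbol) : symbol := fun g n =>
  \sum_(b \in [set: C]) lmul (A b) (hhat b (B (g - b))) n.

Definition scomm (A B : symbol) : symbol := sadd (smul A B) (sopp (smul B A)).

Definition PsiD (A : symbol) : Prop :=
  (forall g, is_laurent (A g)) /\
  exists N : int, forall g n, A g n != 0 ->
    exists i : int, i <= N /\ g = i%:~R.

Definition Jminus (A : symbol) : Prop :=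
  PsiD A /\
  forall g n, A g n != 0 -> exists i : nat, g = - i.+1%:R.

Definition Ghat (a : C) (L : symbol) : Prop :=
  [/\ forall g, is_laurent (L g),
      forall n, L a n = (n == 0)%:R
    & forall g n, L g n != 0 -> exists i : nat, g = a - i%:R].

(* T_L Ghat_a, which does not depend on L. *)
Definition tangent (a : C) (V : symbol) : Prop :=
  exists2 X, Jminus X & V = smul X (Dpow a).

Definition plus_part (A : symbol) : symbol := fun g =>
  if `[< exists i : nat, g = i%:R >] then A g else fun=> 0.

Definition Tr (A : symbol) : C := A 0 0.

Definition sigma (b : C) (X : symbol) : symbol :=
  smul (smul (Dpow b) X) (Dpow (- b)).

(* The complex derivative of the curve [F] at [t] exists coefficientwise and
   equals [V]. *)
Definition sderive (F : C -> symbol) (t : C) (V : symbol) : Prop :=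
  forall g n, @is_derive C C^o C^o t 1 (fun s => F s g n) (V g n).

Definition exp_ode (X : symbol) (A : C -> symbol) : Prop :=
  [/\ forall t, Ghat 0 (A t),
      A 0 = Dpow 0
    & forall t, sderive A t (smul (A t) (sigma t X))].

(* [xget x0 P] is an element of P if there is one, and x0 otherwise. *)
Definition exp_sol (X : symbol) : C -> symbol :=
  xget ((fun=> symb0) : C -> C -> int -> C) [set A | exp_ode X A].

(* exp t(X + ln D) *)
Definition qexp (X : symbol) (t : C) : symbol := smul (exp_sol X t) (Dpow t).

(* The X in J_- with L = exp a(X + ln D), for L of degree a. *)
Definition qlog (a : C) (L : symbol) : symbol :=
  xget (symb0 : C -> int -> C) [set X | Jminus X /\ qexp X a = L].

(* L^b, for L of degree a. *)
Definition cpow (a : C) (L : symbol) (b : C) : symbol :=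
  qexp (qlog a L) (a * b).

(* The right-hand side of the hierarchy. *)
Definition rhs (a : C) (m : nat) (L : symbol) : symbol :=
  scomm (plus_part (cpow a L (m%:R / a))) L.

Definition H (a : C) (k : nat) (L : symbol) : C :=
  a / k%:R * Tr (cpow a L (k%:R / a)).

(* Near t0, L is a family in Ghat_a each of whose coefficients is a series
   sum_(n <= N) f_n(t) z^n with N locally independent of t: this is how a
   family depending on a parameter is read in C((z^-1)), the union of the
   spaces z^N C[[z^-1]]. *)
Definition curve_at (a : C) (L : C -> symbol) (t0 : C^o) : Prop :=
  (\forall t \near t0, Ghat a (L t)) /\
  forall g, exists N : int, \forall t \near t0, forall n, N < n -> L t g n = 0.

(* The m-th equation holds at time t0. *)
Definition solves_at (a : C) (m : nat) (L : C -> symbol) (t0 : C) : Prop :=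
  sderive L t0 (rhs a m (L t0)).

(* W is the value at L0 of d/dt (dL/dtau), where t, tau are the times of the
   m-th and k-th flows: dL/dtau is replaced by the right-hand side of the k-th
   equation and differentiated along the m-th flow.  Only the velocity of the
   curve at L0 is prescribed, so that solutions need not exist; the line
   L0 + (t - t0) (rhs a m L0) is always such a curve. *)
Definition second_derivative (a : C) (m k : nat) (L0 W : symbol) : Prop :=
  forall (L : C -> symbol) (t0 : C),
    curve_at a L t0 -> L t0 = L0 -> solves_at a m L t0 ->
    sderive (fun t => rhs a k (L t)) t0 W.

End Symbols.

(* Main.v *)
Require Import Defs.
From HB Require Import structures.
From mathcomp Require Import all_boot all_order all_algebra.
From mathcomp Require Import complex ring lra zify.
From mathcomp Require Import all_classical all_reals all_analysis.
Set Implicit Arguments.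
Unset Strict Implicit.
Unset Printing Implicit Defensive.
Import Order.TTheory GRing.Theory Num.Theory numFieldNormedType.Exports.
Local Open Scope classical_set_scope.
Local Open Scope ring_scope.
Local Open Scope complex_scope.

(** Every L in Ghat_a is exp a(X + ln D) for one X of degree -1, and L is moved
    inside the one-parameter group E_s = exp s(X + ln D) = A(s) D^s.

    Existence of A(s).  In degree -k the equation A' = A sigma_s(X) only involves
    the coefficients of A in degrees above -k, so A is obtained by integrating one
    degree after the other ([picard], [sexp]) and is unique ([ode_unique]).
    Uniqueness also gives the group law E_s E_r = E_(s+r) ([sexpD], [qexpD]).
    To first order, the coefficient x of z^n D^-k in X enters A(a) as phi_n(a) x,
    where phi_n(a) is the integral of q^(un) over u from 0 to a.  For generic a
    no phi_n(a) vanishes ([phi_neq0]), so X can be solved for degree by degree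
    ([newton], [slog]).

    The right-hand side.  Write M = E_m = M_+ + M_-.  Since M commutes with L,
    [M_+, L] = - [M_-, L] has degree a - 1 ([plus_scomm_qexp]).

    The powers of L.  Along L' = [P, L] with P = M_+, all powers satisfy
    E_s' = [P, E_s] ([sderive_qexp]).  Indeed the defect F_s = E_s' - [P, E_s]
    obeys F_(s+r) = F_s E_r + E_s F_r, and F_a = 0.  The top coefficient f_s of F_s
    then satisfies f_(s+r) = f_s + h^s f_r.  Its z^n part, n <> 0, vanishes because
    the relation is symmetric in s and r and q^(an) <> 1; its z^0 part is an additive
    function of s which is differentiable and vanishes at a, hence is zero
    ([cocycle_zero]).  Differentiability in s, and the existence of E_s' along any
    differentiable curve, come from an explicit form of the coefficients: finite
    sums of f(t) s^j e^(cs) with f differentiable ([sep], [regular]).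

    Commuting flows and conserved quantities.  By the Leibniz rule and the Lax
    equation for powers, the mixed derivative of the flows m and k is
    [[P_m, E_k]_+, L] + [P_k, [P_m, L]].  It is symmetric in m and k by the Jacobi
    identity and [E_m, E_k] = 0 ([zero_curvature]).  The derivative of Tr E_k is
    Tr [P_m, E_k], and the trace of a commutator is zero ([trace_scomm]). *)

(** * Complex derivatives and the complex exponential *)

Section Analysis.

(** First-order expansion with an explicit error: in this form a complex
    derivative restricts to a real line, where only the norm has to be compared. *)
Lemma is_deriveP_eps (K : numFieldType) (f : K^o -> K^o) (a d : K) :
  is_derive (a : K^o) 1 f d <->
  forall e, 0 < e -> \forall h \near (0 : K^o),
    `|f (a + h) - f a - h * d| <= e * `|h|.
Proof.
split.
  case=> /derivable_nbhsP df <- e e0.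
  have /eqaddoP /(_ e e0) := df.
  apply: filterS => h /=; rewrite /cst /=.
  rewrite !fctE /= /cst /= /GRing.scale /= mulr1.
  by rewrite [h + a]addrC opprD addrA.
move=> H.
have Hc : (fun h : K^o => h^-1 *: ((f \o shift a) (h *: (1 : K^o)) - f a)) @ 0^' --> (d : K^o).
  apply/cvgrPdist_le => e e0.
  rewrite near_withinE.
  move: (H e e0); apply: filterS => h /= Hh hN0.
  rewrite /GRing.scale /= mulr1 distrC.
  have -> : h^-1 * (f (h + a) - f a) - d = h^-1 * (f (a + h) - f a - h * d).
    by rewrite [in RHS]mulrBr mulKf // [h + a]addrC.
  by rewrite normrM normfV mulrC ler_pdivrMr ?normr_gt0.
split; first by apply/cvg_ex; exists d.
by apply/cvg_lim.
Qed.

Variable R : realType.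
Local Notation C := R[i].

Lemma Re_le_norm (z : C) : (`|complex.Re z|)%:C <= `|z|.
Proof.
case: z => x y; rewrite normc_def lecR /= -sqrtr_sqr ler_sqrt ?addr_ge0 ?sqr_ge0 //.
by rewrite lerDl sqr_ge0.
Qed.

Lemma Im_le_norm (z : C) : (`|complex.Im z|)%:C <= `|z|.
Proof.
case: z => x y; rewrite normc_def lecR /= -sqrtr_sqr ler_sqrt ?addr_ge0 ?sqr_ge0 //.
by rewrite lerDr sqr_ge0.
Qed.

Lemma near0_complexP (P : set C) :
  (\forall h \near (0 : C^o), P h) <->
  exists2 d : R, 0 < d & forall h : C, `|h| < d%:C -> P h.
Proof.
split.
  move=> /nbhs_ballP[e /= e0] H; move: e0 H; case: e => d d'.
  rewrite ltcE /= => /andP[/eqP -> d0] H.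
  by exists d => // h hd; apply: H; rewrite -ball_normE /ball_ /= sub0r normrN.
move=> [d d0 H]; apply/nbhs_ballP; exists d%:C; first by rewrite /= ltcR.
by move=> h; rewrite -ball_normE /ball_ /= sub0r normrN => /H.
Qed.

Lemma near0_realP (P : set R) :
  (\forall h \near (0 : R^o), P h) <->
  exists2 d : R, 0 < d & forall h : R, `|h| < d -> P h.
Proof.
split.
  move=> /nbhs_ballP[d /= d0] H.
  by exists d => // h hd; apply: H; rewrite -ball_normE /ball_ /= sub0r normrN.
move=> [d d0 H]; apply/nbhs_ballP; exists d => //=.
by move=> h; rewrite -ball_normE /ball_ /= sub0r normrN => /H.
Qed.

(** On the segment from 0 to t, the real and imaginary parts of F are real
    functions with zero derivative, and the real mean value theorem applies. *)
Lemma cder0_cst (F : C -> C) :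
  (forall t : C, is_derive (t : C^o) 1 (F : C^o -> C^o) 0) -> forall t, F t = F 0.
Proof.
move=> dF t.
have key (p : C -> R) : (forall z w, p (z - w) = p z - p w) ->
    (forall z, (`|p z|)%:C <= `|z|) -> p (F t) = p (F 0).
  move=> pB ple.
  pose g (u : R^o) : R^o := p (F (u%:C * t)).
  suff dg : forall u : R, is_derive (u : R^o) 1 g 0.
    have := @is_derive_0_is_cst R g 1 0 dg.
    by rewrite /g mul1r mul0r.
  move=> u; apply/is_deriveP_eps => e e0.
  have /is_deriveP_eps dFu := dF (u%:C * t).
  have t0 : 0 <= complex.Re `|t| by rewrite normc_def /= sqrtr_ge0.
  have nt : `|t| = (complex.Re `|t|)%:C by rewrite normc_def.
  set T := complex.Re `|t| in t0 nt.
  have T0 : 0 < T + 1 by rewrite ltr_wpDl.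
  have e'0 : 0 < (e / (T + 1))%:C :> C by rewrite ltcR divr_gt0.
  have /near0_complexP [d d0 H] := dFu _ e'0.
  apply/near0_realP; exists (d / (T + 1)); first by rewrite divr_gt0.
  move=> h hd; rewrite mulr0 subr0 /g -pB.
  have nht : `|h%:C * t| = (`|h| * T)%:C.
    rewrite normrM nt [in RHS]rmorphM /=; congr (_ * _).
    by rewrite normc_def /= expr0n addr0 sqrtr_sqr.
  have := H (h%:C * t).
  rewrite mulr0 subr0 -mulrDl -rmorphD nht ltcR => H'.
  rewrite -lecR; apply: (le_trans (ple _)); apply: (le_trans (H' _)).
    rewrite ltr_pdivlMr // in hd; apply: le_lt_trans hd.
    by rewrite ler_wpM2l // lerDl.
  rewrite -rmorphM lecR /= mulrAC ler_pdivrMr // -mulrA ler_wpM2l ?(ltW e0) //.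
  by rewrite ler_wpM2l // lerDl.
apply/eqP; rewrite eq_complex; apply/andP; split; apply/eqP.
  by apply: key => [[? ?] [? ?]//|]; exact: Re_le_norm.
by apply: key => [[? ?] [? ?]//|]; exact: Im_le_norm.
Qed.

Lemma norm_le_ReIm (z : C) :
  `|z| <= (`|complex.Re z| + `|complex.Im z|)%:C.
Proof.
case: z => x y; rewrite normc_def lecR /=.
have s0 : 0 <= `|x| + `|y| by rewrite addr_ge0.
rewrite -[leRHS](ger0_norm s0) -sqrtr_sqr ler_sqrt ?sqr_ge0 // sqrrD.
rewrite !real_normK ?num_real // addrAC lerDl.
by rewrite mulrn_wge0 // mulr_ge0.
Qed.

(** With h = x + iy the remainder has real part
    (e^x - 1 - x) + e^x (cos y - 1) and imaginary part
    e^x (sin y - y) + (e^x - 1) y; each term is o(|h|) by the real derivatives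
    of exp, cos and sin at 0. *)
Lemma cexp_at0 (e : C) : 0 < e ->
  \forall h \near (0 : C^o), `|cexp h - 1 - h| <= e * `|h|.
Proof.
case: e => e e'; rewrite ltcE /= => /andP[/eqP -> e0] {e'}.
have d1 := is_derive_expR (0 : R).
have d2 := is_derive_cos (0 : R).
have d3 := is_derive_sin (0 : R).
rewrite expR0 in d1; rewrite sin0 oppr0 in d2; rewrite cos0 in d3.
(* Real part: one term of size (e / 12) |x| and one of size (e / 6) |y|;
   imaginary part: (e / 6) |y| and (e / 12) |y|.  In all at most
   (e / 2) (|x| + |y|) <= e |x + iy|.  The radii 1 / 2 and e / 24 give e^x <= 2
   and |e^x - 1| <= 2 |x| <= e / 12. *)
have k0 : 0 < e / 12 by rewrite divr_gt0.
move/is_deriveP_eps: d1 => d1.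
have /near0_realP[r1 r10 H1] := d1 _ k0.
have /near0_realP[r0 r00 H0] := d1 _ ltr01.
move/is_deriveP_eps: d2 => /(_ _ k0)/near0_realP[r2 r20 H2].
move/is_deriveP_eps: d3 => /(_ _ k0)/near0_realP[r3 r30 H3].
pose r := Num.min (Num.min (Num.min r0 r1) (Num.min r2 r3)) (Num.min (1/2) (e / 24)).
apply/near0_complexP; exists r.
  by rewrite !lt_min r00 r10 r20 r30 !divr_gt0.
move=> [x y] hr.
have hx : `|x| < r by have := le_lt_trans (Re_le_norm (x +i* y)) hr; rewrite ltcR.
have hy : `|y| < r by have := le_lt_trans (Im_le_norm (x +i* y)) hr; rewrite ltcR.
move: hx hy; rewrite !lt_min.
move=> /and3P[/andP[/andP[x0 x1] _] xh xe].
move=> /and3P[/andP[_ /andP[y2 y3]] _ _].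
have {}H1 := H1 _ x1; have {}H0 := H0 _ x0; have {}H2 := H2 _ y2; have {}H3 := H3 _ y3.
move: H0 H1 H2 H3; rewrite !add0r expR0 cos0 sin0 !mulr1 !mulr0 !subr0 mul1r.
move=> H0 H1 H2 H3.
have E1 : `|expR x - 1| <= e / 12.
  have -> : expR x - 1 = (expR x - 1 - x) + x by ring.
  by apply: (le_trans (ler_normD _ _)); lra.
have E2 : `|expR x| <= 2.
  have -> : expR x = (expR x - 1 - x) + (1 + x) by ring.
  apply: (le_trans (ler_normD _ _)); apply: (le_trans (lerD H0 (ler_normD _ _))).
  by rewrite normr1; lra.
apply: (le_trans (norm_le_ReIm _)).
have hn : (`|x| + `|y|)%:C <= 2 * `|x +i* y|.
  rewrite mulr_natl mulr2n rmorphD.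
  exact: lerD (Re_le_norm (x +i* y)) (Im_le_norm (x +i* y)).
apply: (@le_trans _ _ (e / 2 * (`|x| + `|y|))%:C); last first.
  rewrite rmorphM; apply: (le_trans (ler_wpM2l _ hn)).
    by rewrite lecR divr_ge0 // ltW.
  rewrite mulrA ler_wpM2r // -[2]/(2%:R) -(rmorph_nat (real_complex R)) -rmorphM.
  by rewrite lecR /=; lra.
rewrite lecR /=.
have -> : expR x * cos y - 1 - x = (expR x - 1 - x) + expR x * (cos y - 1) by ring.
have -> : expR x * sin y - 0 - y = expR x * (sin y - y) + (expR x - 1) * y by ring.
apply: (@le_trans _ _ ((e / 12 * `|x| + 2 * (e / 12 * `|y|)) + (2 * (e / 12 * `|y|) + e / 12 * `|y|))).
  apply: lerD.
    apply: (le_trans (ler_normD _ _)); apply: lerD => //.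
    by rewrite normrM ler_pM.
  by apply: (le_trans (ler_normD _ _)); apply: lerD; rewrite normrM ler_pM.
have := normr_ge0 x; have := normr_ge0 y; nra.
Qed.

Lemma cexp0 : cexp 0 = 1 :> C.
Proof. by apply/eqP; rewrite eq_complex /= expR0 cos0 sin0 !mul1r !eqxx. Qed.

Lemma cexpD (z w : C) : cexp (z + w) = cexp z * cexp w.
Proof.
case: z w => [x y] [u v]; apply/eqP; rewrite eq_complex /= expRD cosD sinD.
by apply/andP; split; apply/eqP; ring.
Qed.

Lemma is_derive_cexp (c t : C) :
  is_derive (t : C^o) 1 (fun s : C^o => cexp (c * s) : C^o) (c * cexp (c * t)).
Proof.
apply/is_deriveP_eps => e e0.
have M0 : 0 < `|cexp (c * t)| * `|c| + 1 by rewrite ltr_wpDl // mulr_ge0.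
have c0 : 0 < `|c| + 1 by rewrite ltr_wpDl.
have e'0 : 0 < e / (`|cexp (c * t)| * `|c| + 1) by rewrite divr_gt0.
have /near0_complexP[d d0 H] := cexp_at0 e'0.
have dc0 : 0 < d%:C / (`|c| + 1) by rewrite divr_gt0 // ltcR.
have : \forall h \near (0 : C^o), `|h| < d%:C / (`|c| + 1).
  apply/nbhs_ballP; exists (d%:C / (`|c| + 1)) => //=.
  by move=> h; rewrite -ball_normE /ball_ /= sub0r normrN.
apply: filterS => h hd.
have -> : cexp (c * (t + h)) - cexp (c * t) - h * (c * cexp (c * t)) =
    cexp (c * t) * (cexp (c * h) - 1 - c * h).
  by rewrite mulrDr cexpD; ring.
rewrite normrM.
have ch : `|c * h| < d%:C.
  rewrite ltr_pdivlMr // in hd; apply: le_lt_trans hd.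
  by rewrite normrM mulrC ler_wpM2l // lerDl.
apply: (le_trans (ler_wpM2l (normr_ge0 _) (H _ ch))).
rewrite normrM mulrCA -[e in leRHS](divfK (lt0r_neq0 M0)) -!mulrA ler_wpM2l //.
  by rewrite ltW.
by rewrite ler_wpM2l ?invr_ge0 ?(ltW M0) // mulrA ler_wpM2r // lerDl.
Qed.

End Analysis.

(** * Primitives and exponential polynomials depending on a parameter *)

Section ComplexDerivatives.
Variable R : realType.
Local Notation C := R[i].

Notation cder F t d := (@is_derive C C^o C^o t 1 F d).

Lemma cder_cst (a t : C) : cder (fun=> a) t 0.
Proof. exact: (@is_derive_cst C C^o C^o a t 1). Qed.

Lemma cder_eq (F : C -> C) (t d d' : C) : cder F t d -> d = d' -> cder F t d'.
Proof. by move=> h <-. Qed.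

Lemma cder_id (t : C) : cder id t 1.
Proof. exact: (@is_derive_id C C^o t 1). Qed.

Lemma cderD (F G : C -> C) (t d e : C) :
  cder F t d -> cder G t e -> cder (fun s => F s + G s) t (d + e).
Proof. by move=> hF hG; exact: (@is_deriveD C C^o C^o F G t 1 d e). Qed.

Lemma cderN (F : C -> C) (t d : C) : cder F t d -> cder (fun s => - F s) t (- d).
Proof. by move=> hF; exact: (@is_deriveN C C^o C^o F t 1 d). Qed.

Lemma cderB (F G : C -> C) (t d e : C) :
  cder F t d -> cder G t e -> cder (fun s => F s - G s) t (d - e).
Proof. by move=> hF hG; exact: (@is_deriveB C C^o C^o F G t 1 d e). Qed.

Lemma cderM (F G : C -> C) (t d e : C) :
  cder F t d -> cder G t e -> cder (fun s => F s * G s) t (d * G t + F t * e).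
Proof.
move=> hF hG; have h := @is_deriveM C C^o F G t 1 d e hF hG.
apply: (is_derive_eq h).
by rewrite /GRing.scale /= addrC [G t * d]mulrC.
Qed.

Lemma cderZ (a : C) (F : C -> C) (t d : C) :
  cder F t d -> cder (fun s => a * F s) t (a * d).
Proof.
move=> hF; apply: (cder_eq (cderM (cder_cst a t) hF)).
by rewrite mul0r add0r.
Qed.

Lemma cder_unique (F : C -> C) (t d e : C) : cder F t d -> cder F t e -> d = e.
Proof. by move=> [_ <-] [_ <-]. Qed.

Lemma cder_near (F G : C -> C) (t d : C) :
  (\forall s \near (t : C^o), F s = G s) -> cder F t d -> cder G t d.
Proof. by move=> FG; apply: near_eq_is_derive. Qed.

Lemma cder_sum (I : Type) (r : seq I) (F : I -> C -> C) (t : C) (d : I -> C) :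
  (forall i, cder (F i) t (d i)) ->
  cder (fun s => \sum_(i <- r) F i s) t (\sum_(i <- r) d i).
Proof.
move=> h; elim: r => [|i r IH].
  by rewrite big_nil; under eq_fun do rewrite big_nil; exact: cder_cst.
by rewrite big_cons; under eq_fun do rewrite big_cons; exact: cderD.
Qed.

Lemma cderX (n : nat) (t : C) :
  cder (fun s => s ^+ n.+1) t (n.+1%:R * t ^+ n).
Proof.
elim: n => [|n IH].
  by under eq_fun do rewrite expr1; rewrite expr0 mulr1; exact: cder_id.
under eq_fun do rewrite exprS; apply: (cder_eq (cderM (cder_id t) IH)).
by rewrite mul1r mulrCA -exprS -[in RHS]natr1 mulrDl mul1r addrC.
Qed.

Lemma cder_eq_on (F G : C -> C) (d : C -> C) :
  (forall t, cder F t (d t)) -> (forall t, cder G t (d t)) ->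
  F 0 = G 0 -> F =1 G.
Proof.
move=> dF dG FG0 t; apply/eqP; rewrite -subr_eq0; apply/eqP.
rewrite -(subrr (F 0)) {2}FG0.
apply: (cder0_cst (F := fun s => F s - G s)) => s.
by apply: (cder_eq (cderB (dF s) (dG s))); rewrite subrr.
Qed.

Lemma near_all (t0 : C) (P : C -> Prop) :
  (forall t, P t) -> \forall t \near (t0 : C^o), P t.
Proof. by move=> h; near=> t. Unshelve. all: by end_near. Qed.

(** The primitive vanishing at 0, chosen as a total operator so that recursions
    can be written down before the integrands are known to have primitives. *)
Definition prim (f : C -> C) : C -> C :=
  xget (fun=> 0) [set F | F 0 = 0 /\ forall t, cder F t (f t)].

Lemma primE (f F : C -> C) :
  F 0 = 0 -> (forall t, cder F t (f t)) -> prim f = F.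
Proof.
move=> F0 dF; apply: (xget_unique (fun=> 0)); first by split.
move=> G [G0 dG]; apply/funext; apply: cder_eq_on dG dF _.
by rewrite F0 G0.
Qed.

(** The coefficients of exp s(X(t) + ln D) as functions of a parameter t near t0
    and of the exponent s: finite sums of f(t) s^j e^(cs) with f differentiable
    at t0.  The class is closed under sums, products and primitives in s, and
    on it d/dt is taken term by term, with no exchange of limits. *)
Inductive sep (t0 : C) : (C -> C -> C) -> Prop :=
| sep_term f j c : (exists d, cder f t0 d) ->
    sep t0 (fun t s => f t * (s ^+ j * cexp (c * s)))
| sepD F G : sep t0 F -> sep t0 G -> sep t0 (fun t s => F t s + G t s)
| sep_near F G : sep t0 F ->
    (\forall t \near (t0 : C^o), forall s, F t s = G t s) -> sep t0 G.

Lemma sep_eq t0 F G : sep t0 F -> (forall t s, F t s = G t s) -> sep t0 G.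
Proof. by move=> sF FG; apply: (sep_near sF); apply: near_all => t s; exact: FG. Qed.

Lemma sep_param t0 (f : C -> C) d : cder f t0 d -> sep t0 (fun t s => f t).
Proof.
move=> df; apply: (sep_eq (sep_term 0 0 _)); first by exists d; exact: df.
by move=> t s; rewrite expr0 mul0r cexp0 !mulr1.
Qed.

Lemma sep_cst t0 (a : C) : sep t0 (fun _ _ => a).
Proof. exact: sep_param (cder_cst a t0). Qed.

Lemma sep_exp t0 c : sep t0 (fun _ s => cexp (c * s)).
Proof.
apply: (sep_eq (sep_term (f := fun=> 1) 0 c _)).
  by exists 0; exact: cder_cst.
by move=> t s; rewrite !mul1r.
Qed.

Lemma sepM t0 F G : sep t0 F -> sep t0 G -> sep t0 (fun t s => F t s * G t s).
Proof.
move=> sF; elim: sF G => {F} [f j c [d df]|F F' _ IH _ IH'|F F' _ IH FF'] G sG; last first.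
- apply: sep_near (IH _ sG) _; apply: filterS FF' => t h s; by rewrite h.
- by apply: sep_eq (sepD (IH _ sG) (IH' _ sG)) _ => t s; rewrite mulrDl.
elim: sG => {G} [g k e [d' dg]|F F' _ IH _ IH'|F F' _ IH FF']; last first.
- apply: sep_near IH _; apply: filterS FF' => t h s; by rewrite h.
- by apply: sep_eq (sepD IH IH') _ => t s; rewrite mulrDr.
apply: (sep_eq (sep_term (f := fun t => f t * g t) (j + k) (c + e) _)).
  by eexists; exact: cderM df dg.
by move=> t s; rewrite mulrDl cexpD exprD; ring.
Qed.

Lemma sepN t0 F : sep t0 F -> sep t0 (fun t s => - F t s).
Proof.
move=> sF; apply: sep_eq (sepM (sep_cst t0 (-1)) sF) _ => t s.
by rewrite mulN1r.
Qed.

Lemma cder_exp (c t : C) : cder (fun s => cexp (c * s)) t (c * cexp (c * t)).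
Proof. exact: is_derive_cexp. Qed.

(** The derivative in t is again differentiable in s: this is what [additive_zero]
    needs. *)
Lemma sep_derive t0 F : sep t0 F -> exists F' : C -> C,
  forall s, cder (fun t => F t s) t0 (F' s) /\ exists d, cder F' s d.
Proof.
elim=> {F} [f j c [d df]|F G _ [F' hF] _ [G' hG]|F G _ [F' hF] FG].
- exists (fun s => d * (s ^+ j * cexp (c * s))) => s; split.
    have := cderM df (cder_cst (s ^+ j * cexp (c * s)) t0).
    by rewrite mulr0 addr0.
  have [e de] : exists e, cder (fun s => s ^+ j) s e.
    by case: j => [|j]; eexists; [exact: cder_cst|exact: cderX].
  by eexists; exact: cderZ (cderM de (cder_exp c s)).
- exists (fun s => F' s + G' s) => s.
  have [dF [d d']] := hF s; have [dG [e e']] := hG s.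
  by split; [exact: cderD|eexists; exact: (cderD d' e')].
- exists F' => s; have [dF d'] := hF s; split=> //.
  by apply: cder_near dF; apply: filterS FG => t ->.
Qed.

(** Integration by parts lowers j when c <> 0.  Multiplied by any f(t), the
    primitive stays in the class [sep]. *)
Lemma prim_expoly (j : nat) (c : C) : exists P : C -> C,
  [/\ forall t0 f d, cder f t0 d -> sep t0 (fun t s => f t * P s), P 0 = 0
    & forall s, cder P s (s ^+ j * cexp (c * s))].
Proof.
have [->|c0] := eqVneq c 0.
  exists (fun s => j.+1%:R^-1 * s ^+ j.+1); split.
  - move=> t0 f d df.
    apply: (sep_eq (sep_term (f := fun t => f t * j.+1%:R^-1) j.+1 0 _)).
      eexists; exact: cderM df (cder_cst _ _).
    by move=> t s; rewrite mul0r cexp0 mulr1 mulrA.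
  - by rewrite expr0n mulr0.
  - move=> s; apply: (cder_eq (cderZ _ (cderX j s))).
    by rewrite mulKf ?pnatr_eq0 // mul0r cexp0 mulr1.
elim: j => [|j [P [sP P0 dP]]].
  exists (fun s => c^-1 * cexp (c * s) - c^-1); split.
  - move=> t0 f d df.
    apply: (sep_eq (sepD (sep_term (f := fun t => f t * c^-1) 0 c _)
                         (sep_param (cderM df (cder_cst (- c^-1) t0))))).
    + by eexists; exact: cderM df (cder_cst _ _).
    + by move=> t s; rewrite expr0; ring.
  - by rewrite mulr0 cexp0 mulr1 subrr.
  - move=> s; apply: (cder_eq (cderB (cderZ _ (cder_exp c s)) (cder_cst _ _))).
    by rewrite mulKf // subr0 mul1r.
exists (fun s => c^-1 * (s ^+ j.+1 * cexp (c * s)) - c^-1 * j.+1%:R * P s); split.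
- move=> t0 f d df.
  apply: (sep_eq (sepD (sep_term (f := fun t => f t * c^-1) j.+1 c _)
                       (sP _ _ _ (cderM df (cder_cst (- (c^-1 * j.+1%:R)) t0))))).
  + by eexists; exact: cderM df (cder_cst _ _).
  + by move=> t s; ring.
- by rewrite expr0n mul0r mulr0 P0 mulr0 subrr.
- move=> s; apply: (cder_eq (cderB (cderZ _ (cderM (cderX j s) (cder_exp c s)))
    (cderZ _ (dP s)))).
  by rewrite mulrDr !mulrA [c^-1 * _ * c]mulrAC mulVf // mul1r; ring.
Qed.

Lemma sep_prim_ex t0 F : sep t0 F -> exists G, sep t0 G /\
  \forall t \near (t0 : C^o), G t 0 = 0 /\ forall s, cder (G t) s (F t s).
Proof.
elim=> {F} [f j c [d df]|F G _ [F' [sF hF]] _ [G' [sG hG]]|F G _ [F' [sF hF]] FG].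
- have [P [sP P0 dP]] := prim_expoly j c.
  exists (fun t s => f t * P s); split; first exact: sP df.
  by apply: near_all => t; rewrite P0 mulr0; split=> // s; exact: cderZ.
- exists (fun t s => F' t s + G' t s); split; first exact: sepD.
  apply: filterS2 hF hG => t [F0 dF] [G0 dG].
  by rewrite F0 G0 addr0; split=> // s; exact: cderD.
- exists F'; split=> //.
  apply: filterS2 hF FG => t [F0 dF] FG; split=> // s; rewrite -FG; exact: dF.
Qed.

Lemma sep_prim t0 F : sep t0 F -> sep t0 (fun t s => prim (F t) s).
Proof.
move=> /sep_prim_ex[G [sG hG]]; apply: sep_near sG _.
by apply: filterS hG => t [G0 dG] s; rewrite (primE G0 dG).
Qed.

Lemma prim0 (f : C -> C) : prim f 0 = 0.
Proof. by rewrite /prim; case: xgetP => // F _ []. Qed.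

Lemma cder_prim t0 F : sep t0 F -> \forall t \near (t0 : C^o),
  forall s, cder (prim (F t)) s (F t s).
Proof.
move=> /sep_prim_ex[G [_ hG]]; apply: filterS hG => t [G0 dG] s.
by rewrite (primE G0 dG); exact: dG.
Qed.

End ComplexDerivatives.

(** * Supports of symbols and the product *)

Section SymbolAlgebra.
Variable R : realType.
Variable lnq : R[i].
Local Notation C := R[i].
Local Notation symbol := (@symbol R).
Local Notation qpow := (qpow lnq).
Local Notation smul := (smul lnq).

Lemma qpowD a b : qpow (a + b) = qpow a * qpow b.
Proof. by rewrite /Defs.qpow mulrDl cexpD. Qed.

Lemma qpow0 : qpow 0 = 1.
Proof. by rewrite /Defs.qpow mul0r cexp0. Qed.

Lemma qpow_neq0 a : qpow a != 0.
Proof.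
apply/eqP => h; have := qpowD a (- a); rewrite subrr qpow0 h mul0r => /eqP.
by rewrite oner_eq0.
Qed.

Lemma qpowDz a b (n : int) : qpow (a + b) ^ n = qpow a ^ n * qpow b ^ n.
Proof. by rewrite qpowD expfzMl. Qed.

(** As a function of the exponent a, the factor of h^a on z^n is an exponential,
    which keeps the coefficients of exp s(X + ln D) in the class [sep]. *)
Lemma qpow_expz a (n : int) : qpow a ^ n = cexp (lnq * n%:~R * a).
Proof.
have nat_case (k : nat) : qpow a ^+ k = cexp (lnq * k%:R * a).
  elim: k => [|k IH]; first by rewrite expr0 mulr0 mul0r cexp0.
  by rewrite exprS IH -cexpD -natr1; congr cexp; ring.
case: n => k; first by rewrite -exprnP nat_case.
rewrite NegzE -exprnN nat_case mulrNz mulrN mulNr.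
apply: (mulfI (x := cexp (lnq * k.+1%:R * a))); last first.
  by rewrite -cexpD subrr cexp0 mulfV // -nat_case expf_neq0 // qpow_neq0.
by rewrite -nat_case expf_neq0 // qpow_neq0.
Qed.

Definition below (a g : C) : Prop := exists i : nat, g = a - i%:R.

Lemma belowD a b g h : below a g -> below b h -> below (a + b) (g + h).
Proof.
by move=> [i ->] [j ->]; exists (i + j)%N; rewrite natrD opprD addrACA.
Qed.

(** If g = a + b - k, the exponents are a - i with i <= k. *)
Lemma below_degrees a b g : exists bs : seq C,
  forall b', below a b' -> below b (g - b') -> b' \in bs.
Proof.
have [[k gk]|nb] := pselect (below (a + b) g); last first.
  exists [::] => b' ha hb; case: nb.
  by rewrite -[g](subrKC b'); exact: belowD.
exists [seq a - i%:R | i <- iota 0 k.+1] => b' [i ->] [j hj].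
apply/mapP; exists i => //; rewrite mem_iota /= add0n ltnS.
move: hj; rewrite gk => /eqP; rewrite -subr_eq0 => /eqP h.
have : (i + j)%:R - k%:R = 0 :> C by rewrite -h natrD; ring.
move/eqP; rewrite subr_eq0 eqr_nat => /eqP <-; exact: leq_addr.
Qed.

Lemma int_interval (lo hi : int) :
  exists s : seq int, forall i, lo <= i -> i <= hi -> i \in s.
Proof.
exists [seq lo + k%:Z | k <- iota 0 `|hi - lo|%N.+1] => i li ih.
apply/mapP; exists `|i - lo|%N; last by lia.
by rewrite mem_iota /=; lia.
Qed.

(** Bounds are put on supports rather than on coefficients: a support bound is
    inherited by derivatives and can be shared by a whole family. *)
Definition bounded_supp (a : C) (S : C -> int -> Prop) : Prop :=
  (forall g n, S g n -> below a g) /\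
  forall g, exists N : int, forall n, S g n -> n <= N.

Definition supp_add (S T : C -> int -> Prop) : C -> int -> Prop :=
  fun g n => exists b i, S b i /\ T (g - b) (n - i).

Lemma bounded_supp_indices a b S T : bounded_supp a S -> bounded_supp b T ->
  forall (bs : seq C) g n, exists js : seq int,
    forall b' i, b' \in bs -> S b' i -> T (g - b') (n - i) -> i \in js.
Proof.
move=> [_ hS] [_ hT] bs g n.
have /choice[f hf] : forall b', exists js : seq int, forall i,
    S b' i -> T (g - b') (n - i) -> i \in js.
  move=> b'; have [N hN] := hS b'; have [M hM] := hT (g - b').
  have [s hs] := int_interval (n - M) N.
  exists s => i /hN iN /hM iM; apply: hs => //; lia.
exists (flatten [seq f b' | b' <- bs]) => b' i hb hSi hTi.
by apply/flatten_mapP; exists b' => //; exact: hf.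
Qed.

Lemma bounded_suppD a b S T :
  bounded_supp a S -> bounded_supp b T -> bounded_supp (a + b) (supp_add S T).
Proof.
move=> hS hT; split.
  move=> g n [b' [i [/hS.1 h1 /hT.1 h2]]].
  by rewrite -[g](subrKC b'); exact: belowD.
move=> g; have [bs hbs] := below_degrees a b g.
have : exists N : int, forall b' i n, b' \in bs -> S b' i -> T (g - b') (n - i) -> n <= N.
  elim: bs {hbs} => [|b0 bs [N hN]]; first by exists 0.
  have [N1 h1] := hS.2 b0; have [N2 h2] := hT.2 (g - b0).
  exists (Num.max (N1 + N2) N) => b' i n; rewrite inE => /orP[/eqP->|hb] Si Ti.
    by have := h1 _ Si; have := h2 _ Ti; rewrite le_max; lia.
  by have := hN _ _ _ hb Si Ti; rewrite le_max => ->; rewrite orbT.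
move=> [N hN]; exists N => n [b' [i [Si Ti]]].
by apply: (hN b' i) => //; apply: hbs; [exact: hS.1 Si|exact: hT.1 Ti].
Qed.

Lemma near_seq (T : Type) (F : set_system T) (FF : Filter F) (I : eqType)
    (s : seq I) (P : I -> T -> Prop) :
  (forall i, \forall t \near F, P i t) ->
  \forall t \near F, forall i, i \in s -> P i t.
Proof.
move=> h; elim: s => [|i s IH]; first by apply: filterE.
apply: filterS2 (h i) IH => t hi hs j; rewrite inE => /orP[/eqP->//|].
exact: hs.
Qed.

(** A family with one support bound for all its members near F.  In each degree
    g the bound holds eventually, at a rate that may depend on g: this is the
    boundedness of a curve in the union of the spaces z^N C[[z^-1]]. *)
Definition ubounded (T : Type) (F : set_system T) (a : C) (A : T -> symbol) :=
  (\forall t \near F, forall g n, A t g n != 0 -> below a g) /\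
  exists S, bounded_supp a S /\
    forall g, \forall t \near F, forall n, A t g n != 0 -> S g n.

Definition bounded (a : C) (A : symbol) : Prop :=
  bounded_supp a (fun g n => A g n != 0).

Lemma bounded_ubounded T (F : set_system T) (FF : Filter F) a A :
  bounded a A -> ubounded F a (fun=> A).
Proof.
move=> hA; split; first by apply: filterE => t; exact: hA.1.
by exists (fun g n => A g n != 0); split=> // g; apply: filterE.
Qed.

Lemma ubounded_at T (F : set_system T) a (A : T -> symbol) t :
  (forall P : set T, F P -> P t) -> ubounded F a A -> bounded a (A t).
Proof.
move=> Ft [h1 [S [hS h2]]]; split; first exact: (Ft _ h1).
move=> g; have [N hN] := hS.2 g; exists N => n hn; apply: hN.
exact: (Ft _ (h2 g)).
Qed.

Lemma fsumT_seq (I : choiceType) (V : nmodType) (r : seq I) (f : I -> V) :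
  uniq r -> (forall i, i \notin r -> f i = 0) ->
  \sum_(i \in [set: I]) f i = \sum_(i <- r) f i.
Proof.
move=> ur hr; rewrite (fsbigE r) // ?(@big_mkcond _ _ _ _ r) /=.
  by apply: eq_bigr => i _; rewrite in_setT.
by move=> i _; exact: hr.
Qed.

Definition smul_term (A B : symbol) g n (p : C * int) : C :=
  A p.1 p.2 * (qpow p.1 ^ (n - p.2) * B (g - p.1) (n - p.2)).

(** Replaces the sums over all of C and int by a sum over any finite set that
    contains the contributing pairs; such a set can be chosen once for a family. *)
Lemma smul_finite (A B : symbol) g n (ps : seq (C * int)) : uniq ps ->
  (forall b i, A b i != 0 -> B (g - b) (n - i) != 0 -> (b, i) \in ps) ->
  smul A B g n = \sum_(p <- ps) smul_term A B g n p.
Proof.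
move=> ups hps.
have h0 b i : (b, i) \notin ps -> smul_term A B g n (b, i) = 0.
  move=> hbi; rewrite /smul_term /=.
  have [->|A0] := eqVneq (A b i) 0; first by rewrite mul0r.
  have [->|B0] := eqVneq (B (g - b) (n - i)) 0; first by rewrite !mulr0.
  by rewrite hps in hbi.
pose bs := undup [seq p.1 | p <- ps]; pose js := undup [seq p.2 | p <- ps].
have nbs b i : b \notin bs -> (b, i) \notin ps.
  by move=> hb; apply: contraNN hb => hb; rewrite mem_undup; apply/mapP; exists (b, i).
have njs b i : i \notin js -> (b, i) \notin ps.
  by move=> hb; apply: contraNN hb => hb; rewrite mem_undup; apply/mapP; exists (b, i).
have -> : smul A B g n = \sum_(b <- bs) \sum_(i <- js) smul_term A B g n (b, i).
  rewrite /Defs.smul (fsumT_seq (r := bs)) ?undup_uniq //; last first.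
    move=> b hb; rewrite /lmul /hhat; apply: fsbig1 => i _.
    exact: h0 (nbs _ i hb).
  apply: eq_bigr => b _; rewrite /lmul (fsumT_seq (r := js)) ?undup_uniq //.
  by move=> i hi; exact: h0 (njs b _ hi).
rewrite -big_allpairs.
rewrite -[LHS]fsumT_seq ?allpairs_uniq ?undup_uniq //.
- by rewrite (fsumT_seq (r := ps)) // => -[b i]; exact: h0.
- by move=> [? ?] [? ?].
- move=> [b i] hbi; apply: h0; apply: contraNN hbi => hbi.
  apply/allpairsP; exists (b, i); split=> //; rewrite mem_undup; apply/mapP; by exists (b, i).
Qed.

Lemma smul_neq0 (A B : symbol) g n : smul A B g n != 0 ->
  exists b i, A b i != 0 /\ B (g - b) (n - i) != 0.
Proof.
apply: contraPP => h; apply/negP; rewrite negbK; apply/eqP.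
rewrite /Defs.smul; apply: fsbig1 => b _; apply: fsbig1 => i _; rewrite /hhat.
have [->|A0] := eqVneq (A b i) 0; first by rewrite mul0r.
have [->|B0] := eqVneq (B (g - b) (n - i)) 0; first by rewrite !mulr0.
by case: h; exists b, i.
Qed.

Lemma supp_finite a b S U : bounded_supp a S -> bounded_supp b U ->
  forall g n, exists ps : seq (C * int),
    uniq ps /\ forall b' i, S b' i -> U (g - b') (n - i) -> (b', i) \in ps.
Proof.
move=> hS hU g n; have [bs hbs] := below_degrees a b g.
have [js hjs] := bounded_supp_indices hS hU bs g n.
exists (undup [seq (b', i) | b' <- bs, i <- js]); split; first exact: undup_uniq.
move=> b' i A0 B0; rewrite mem_undup.
have b'bs : b' \in bs by apply: hbs; [exact: hS.1 A0|exact: hU.1 B0].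
by apply/allpairsP; exists (b', i); split=> //=; exact: (hjs b' i b'bs).
Qed.

(** The index set depends only on the support bounds S and U, so it also serves
    for products in which a factor is replaced by its derivative. *)
Lemma smul_near (T : Type) (F : set_system T) (FF : Filter F) a b
    (A B : T -> symbol) : ubounded F a A -> ubounded F b B ->
  exists S U, [/\ forall g, \forall t \near F, forall n, A t g n != 0 -> S g n,
    forall g, \forall t \near F, forall n, B t g n != 0 -> U g n
    & forall g n, exists ps : seq (C * int),
      [/\ uniq ps, forall b' i, S b' i -> U (g - b') (n - i) -> (b', i) \in ps
        & \forall t \near F,
          smul (A t) (B t) g n = \sum_(p <- ps) smul_term (A t) (B t) g n p]].
Proof.
move=> [hA [S [hS AS]]] [hB [U [hU BU]]]; exists S, U; split=> // g n.
have [bs hbs] := below_degrees a b g.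
have [ps [ups hps]] := supp_finite hS hU g n.
exists ps; split=> //.
have AS' := near_seq FF bs AS.
have BU' := near_seq FF bs (fun b' => BU (g - b')).
near=> t; apply: smul_finite => // b' i A0 B0.
have b'bs : b' \in bs.
  apply: hbs.
    by apply: (near hA t _ _ _ A0).
  by apply: (near hB t _ _ _ B0).
apply: hps.
  by apply: (near AS' t).
by apply: (near BU' t).
Unshelve. all: by end_near. Qed.

Lemma ubounded_smul (T : Type) (F : set_system T) (FF : Filter F) a b
    (A B : T -> symbol) : ubounded F a A -> ubounded F b B ->
  ubounded F (a + b) (fun t => smul (A t) (B t)).
Proof.
move=> [hA [S [hS AS]]] [hB [U [hU BU]]]; split.
  near=> t => g n /smul_neq0[b' [i [A0 B0]]].
  rewrite -[g](subrKC b'); apply: belowD.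
    by apply: (near hA t _ _ _ A0).
  by apply: (near hB t _ _ _ B0).
exists (supp_add S U); split; first exact: bounded_suppD.
move=> g; have [bs hbs] := below_degrees a b g.
have AS' := near_seq FF bs AS.
have BU' := near_seq FF bs (fun b' => BU (g - b')).
near=> t => n /smul_neq0[b' [i [A0 B0]]].
have b'bs : b' \in bs.
  apply: hbs.
    by apply: (near hA t _ _ _ A0).
  by apply: (near hB t _ _ _ B0).
exists b', i; split.
  by apply: (near AS' t).
by apply: (near BU' t).
Unshelve. all: by end_near. Qed.

(** A single symbol is a family over a point, so that statements about families
    cover both cases. *)
Lemma boundedP a A : bounded a A <-> ubounded (principal_filter tt) a (fun=> A).
Proof.
split; first exact: bounded_ubounded.
by apply: (ubounded_at (t := tt)) => P; rewrite principal_filterP.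
Qed.

Lemma bounded_smul a b A B :
  bounded a A -> bounded b B -> bounded (a + b) (smul A B).
Proof. by rewrite !boundedP => hA hB; exact: ubounded_smul. Qed.

Lemma lmul0l f : lmul (fun=> 0 : C) f = (fun=> 0).
Proof. by apply/funext => n; apply: fsbig1 => i _; rewrite mul0r. Qed.

Lemma smul_DpowrE A t g n : smul A (Dpow t) g n = A (g - t) n.
Proof.
rewrite (@smul_finite _ _ _ _ [:: (g - t, n)]) //.
  rewrite big_seq1 /smul_term /Dpow /= subrr expr0z mul1r.
  by rewrite subKr !eqxx mulr1.
move=> b i _; rewrite /Dpow; case: andP => [[/eqP h1 /eqP h2] _|]; last by rewrite eqxx.
by rewrite inE xpair_eqE -h1 subKr eqxx /=; apply/eqP; lia.
Qed.

Lemma smul_DpowlE A t g n : smul (Dpow t) A g n = qpow t ^ n * A (g - t) n.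
Proof.
rewrite (@smul_finite _ _ _ _ [:: (t, 0)]) //.
  by rewrite big_seq1 /smul_term /Dpow /= !eqxx /= subr0 mul1r.
move=> b i; rewrite /Dpow; case: andP => [[/eqP -> /eqP ->] _ _|]; last by rewrite eqxx.
by rewrite inE.
Qed.

Lemma sigmaE t A g n : sigma lnq t A g n = qpow t ^ n * A g n.
Proof. by rewrite /sigma smul_DpowrE smul_DpowlE opprK addrK. Qed.

Lemma bounded_Dpow t : bounded t (Dpow t).
Proof.
split=> [g n|g].
  rewrite /Dpow; case: andP => [[/eqP -> _] _|]; last by rewrite eqxx.
  by exists 0%N; rewrite subr0.
exists 0 => n; rewrite /Dpow; case: andP => [[_ /eqP -> _] //|]; by rewrite eqxx.
Qed.

Lemma smul_Dpow0 A : smul A (Dpow 0) = A.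
Proof. by apply/funext => g; apply/funext => n; rewrite smul_DpowrE subr0. Qed.

Lemma Dpow0_smul A : smul (Dpow 0) A = A.
Proof.
by apply/funext => g; apply/funext => n; rewrite smul_DpowlE subr0 qpow0 exp1rz mul1r.
Qed.

Lemma smul_Dpow t s : smul (Dpow t) (Dpow s) = Dpow (t + s).
Proof.
apply/funext => g; apply/funext => n; rewrite smul_DpowrE /Dpow.
by congr (nat_of_bool (_ && _))%:R; rewrite subr_eq.
Qed.

Lemma ubounded_sub (T : Type) (F : set_system T) (FF : Filter F) a
    (A B : T -> symbol) : ubounded F a A ->
  (\forall t \near F, forall g n, B t g n != 0 -> A t g n != 0) ->
  ubounded F a B.
Proof.
move=> [hA [S [hS AS]]] BA; split.
  by apply: filterS2 hA BA => t h1 h2 g n /h2; exact: h1.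
exists S; split=> // g; apply: filterS2 (AS g) BA => t h1 h2 n /h2; exact: h1.
Qed.

Lemma ubounded_add (T : Type) (F : set_system T) (FF : Filter F) a
    (A B : T -> symbol) : ubounded F a A -> ubounded F a B ->
  ubounded F a (fun t => sadd (A t) (B t)).
Proof.
move=> [hA [S [hS AS]]] [hB [U [hU BU]]]; split.
  apply: filterS2 hA hB => t h1 h2 g n; rewrite /sadd => h.
  have [A0|/h1//] := eqVneq (A t g n) 0.
  by apply: (h2 g n); move: h; rewrite A0 add0r.
exists (fun g n => S g n \/ U g n); split.
  split=> [g n [/hS.1|/hU.1]//|g].
  have [N hN] := hS.2 g; have [M hM] := hU.2 g.
  by exists (Num.max N M) => n [/hN|/hM]; rewrite le_max => ->; rewrite ?orbT.
move=> g; apply: filterS2 (AS g) (BU g) => t h1 h2 n; rewrite /sadd => h.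
have [A0|/h1 ?] := eqVneq (A t g n) 0; last by left.
by right; apply: (h2 n); move: h; rewrite A0 add0r.
Qed.

Lemma ubounded_opp (T : Type) (F : set_system T) (FF : Filter F) a
    (A : T -> symbol) : ubounded F a A -> ubounded F a (fun t => sopp (A t)).
Proof.
move=> hA; apply: (ubounded_sub _ hA); apply: filterE => t g n.
by rewrite /sopp oppr_eq0.
Qed.

Lemma below_weaken a g (i : nat) : below a g -> below (a + i%:R) g.
Proof. by move=> [j ->]; exists (i + j)%N; rewrite natrD; ring. Qed.

Lemma ubounded_weaken (T : Type) (F : set_system T) (FF : Filter F) a (i : nat)
    (A : T -> symbol) : ubounded F a A -> ubounded F (a + i%:R) A.
Proof.
move=> [hA [S [hS AS]]]; split.
  by apply: filterS hA => t h g n /h; exact: below_weaken.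
exists S; split=> //; split; last exact: hS.2.
by move=> g n /hS.1; exact: below_weaken.
Qed.

Lemma bounded_sub a A B : bounded a A ->
  (forall g n, B g n != 0 -> A g n != 0) -> bounded a B.
Proof.
move=> hA h; split=> [g n /h|g]; first exact: hA.1.
by have [N hN] := hA.2 g; exists N => n /h; exact: hN.
Qed.

Lemma bounded_add a A B : bounded a A -> bounded a B -> bounded a (sadd A B).
Proof. by rewrite !boundedP => hA hB; exact: ubounded_add. Qed.

Lemma bounded_opp a A : bounded a A -> bounded a (sopp A).
Proof. by rewrite !boundedP => hA; exact: ubounded_opp. Qed.

Lemma bounded_weaken a (i : nat) A : bounded a A -> bounded (a + i%:R) A.
Proof. by rewrite !boundedP => hA; exact: ubounded_weaken. Qed.

Lemma bounded_scomm a b A B : bounded a A -> bounded b B ->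
  bounded (a + b) (scomm lnq A B).
Proof.
move=> hA hB; apply: bounded_add; first exact: bounded_smul.
by apply: bounded_opp; rewrite addrC; exact: bounded_smul.
Qed.

(** The product is a convolution over the group C x int of the monomials z^n D^g,
    twisted by a bicharacter.  Both sides become finite double sums, exchanged
    and compared through the substitution x = y + (index of B). *)
Lemma smulA a b c A B D : bounded a A -> bounded b B -> bounded c D ->
  smul (smul A B) D = smul A (smul B D).
Proof.
move=> hA hB hD; apply/funext => g; apply/funext => n.
have [ys [uys hys]] := supp_finite hA (bounded_suppD hB hD) g n.
have [xs [uxs hxs]] := supp_finite (bounded_suppD hA hB) hD g n.
rewrite (smul_finite uxs); last first.
  by move=> x j /smul_neq0 h D0; exact: hxs.
rewrite (smul_finite uys); last first.
  move=> y i A0 /smul_neq0[b' [j [B0 D0]]]; apply: hys => //.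
  by exists b', j.
transitivity (\sum_(x <- xs) \sum_(y <- ys)
    smul_term A B x.1 x.2 y * (qpow x.1 ^ (n - x.2) * D (g - x.1) (n - x.2))).
  apply: eq_bigr => -[x j] _; rewrite /smul_term /=.
  have [D0|D0] := eqVneq (D (g - x) (n - j)) 0.
    by rewrite D0 !mulr0 big1 // => *; rewrite !mulr0.
  rewrite (smul_finite uys) ?mulr_suml // => y i A0 B0; apply: hys => //.
  by exists (x - y), (j - i); split=> //; rewrite !opprB !addrA !subrK.
rewrite exchange_big; apply: eq_bigr => -[y i] _; rewrite /smul_term /=.
have [->|A0] := eqVneq (A y i) 0.
  by rewrite mul0r big1 // => *; rewrite !mul0r.
have uzs : uniq [seq (x.1 - y, x.2 - i) | x <- xs].
  rewrite map_inj_uniq // => -[u1 u2] [v1 v2] /= [/addIr -> h].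
  by congr pair; lia.
rewrite (smul_finite uzs); last first.
  move=> b' l B0 D0; apply/mapP; exists (b' + y, l + i); rewrite /= ?addrK //.
  apply: hxs; first by exists y, i; rewrite !addrK.
  by rewrite ![_ + y]addrC ![_ + i]addrC !opprD !addrA.
rewrite big_map mulrA [RHS]big_distrr /=.
apply: eq_bigr => -[x j] _; rewrite /smul_term /=.
rewrite !opprB !addrA !subrK.
have -> : qpow y ^ (n - i) = qpow y ^ (j - i) * qpow y ^ (n - j).
  by rewrite -expfzDr ?qpow_neq0 //; congr (_ ^ _); lia.
have -> : qpow x ^ (n - j) = qpow y ^ (n - j) * qpow (x - y) ^ (n - j).
  by rewrite -qpowDz subrKC.
by rewrite -!mulrA; congr (_ * (_ * _)); rewrite mulrCA.
Qed.

Lemma smul_finite2 a b c d A B A' B' : bounded a A -> bounded b B ->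
  bounded c A' -> bounded d B' -> forall g n, exists ps : seq (C * int),
  [/\ uniq ps,
    forall b i, A b i != 0 -> B (g - b) (n - i) != 0 -> (b, i) \in ps
    & forall b i, A' b i != 0 -> B' (g - b) (n - i) != 0 -> (b, i) \in ps].
Proof.
move=> hA hB hA' hB' g n.
have [ps [ups hps]] := supp_finite hA hB g n.
have [qs [uqs hqs]] := supp_finite hA' hB' g n.
exists (undup (ps ++ qs)); split; first exact: undup_uniq.
  by move=> *; rewrite mem_undup mem_cat hps.
by move=> *; rewrite mem_undup mem_cat hqs ?orbT.
Qed.

Lemma smulDl a b c A A' B : bounded a A -> bounded b A' -> bounded c B ->
  smul (sadd A A') B = sadd (smul A B) (smul A' B).
Proof.
move=> hA hA' hB; apply/funext => g; apply/funext => n.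
have [ps [ups h1 h2]] := smul_finite2 hA hB hA' hB g n.
rewrite /sadd !(smul_finite ups) //.
  by rewrite -big_split; apply: eq_bigr => p _; rewrite /smul_term mulrDl.
move=> x i h B0; have [A0|A0] := eqVneq (A x i) 0; last exact: h1.
by apply: h2 => //; move: h; rewrite A0 add0r.
Qed.

Lemma smulDr a b c A B B' : bounded a A -> bounded b B -> bounded c B' ->
  smul A (sadd B B') = sadd (smul A B) (smul A B').
Proof.
move=> hA hB hB'; apply/funext => g; apply/funext => n.
have [ps [ups h1 h2]] := smul_finite2 hA hB hA hB' g n.
rewrite /sadd !(smul_finite ups) //.
  by rewrite -big_split; apply: eq_bigr => p _; rewrite /smul_term !mulrDr.
move=> x i A0 h; have [B0|B0] := eqVneq (B (g - x) (n - i)) 0; last exact: h1.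
by apply: h2 => //; move: h; rewrite B0 add0r.
Qed.

Lemma smulNl a b A B : bounded a A -> bounded b B ->
  smul (sopp A) B = sopp (smul A B).
Proof.
move=> hA hB; apply/funext => g; apply/funext => n.
have [ps [ups h1]] := supp_finite hA hB g n.
rewrite /sopp !(smul_finite ups) //.
  by rewrite -sumrN; apply: eq_bigr => p _; rewrite /smul_term mulNr.
by move=> x i; rewrite oppr_eq0; exact: h1.
Qed.

Lemma smulNr a b A B : bounded a A -> bounded b B ->
  smul A (sopp B) = sopp (smul A B).
Proof.
move=> hA hB; apply/funext => g; apply/funext => n.
have [ps [ups h1]] := supp_finite hA hB g n.
rewrite /sopp !(smul_finite ups) //.
  by rewrite -sumrN; apply: eq_bigr => p _; rewrite /smul_term !mulrN.
by move=> x i h; rewrite oppr_eq0; exact: h1.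
Qed.

Lemma scomm_smulr a b c P A B : bounded a P -> bounded b A -> bounded c B ->
  scomm lnq P (smul A B) =
  sadd (smul (scomm lnq P A) B) (smul A (scomm lnq P B)).
Proof.
move=> hP hA hB.
have PA := bounded_smul hP hA; have AP := bounded_smul hA hP.
have PB := bounded_smul hP hB; have BP := bounded_smul hB hP.
rewrite /scomm (smulDl PA (bounded_opp AP) hB) (smulDr hA PB (bounded_opp BP)).
rewrite (smulNl AP hB) (smulNr hA BP) (smulA hP hA hB) (smulA hA hP hB).
rewrite (smulA hA hB hP).
by apply/funext => g; apply/funext => n; rewrite /sadd /sopp; ring.
Qed.

(** The Jacobi identity, as [ad A, ad B] = ad [A, B]. *)
Lemma scomm_scomm a b c A B D : bounded a A -> bounded b B -> bounded c D ->
  sadd (scomm lnq A (scomm lnq B D)) (sopp (scomm lnq B (scomm lnq A D))) =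
  scomm lnq (scomm lnq A B) D.
Proof.
move=> hA hB hD.
have AB := bounded_smul hA hB; have BA := bounded_smul hB hA.
have BD := bounded_smul hB hD; have DB := bounded_smul hD hB.
have AD := bounded_smul hA hD; have DA := bounded_smul hD hA.
rewrite /scomm (smulDl AB (bounded_opp BA) hD) (smulDr hD AB (bounded_opp BA)).
rewrite (smulNl BA hD) (smulNr hD BA).
rewrite (smulDr hA BD (bounded_opp DB)) (smulDl BD (bounded_opp DB) hA).
rewrite (smulDr hB AD (bounded_opp DA)) (smulDl AD (bounded_opp DA) hB).
rewrite !(smulNl DA hB) !(smulNr hB DA) !(smulNl DB hA) !(smulNr hA DB).
rewrite !(smulA hA hB hD) !(smulA hB hA hD) !(smulA hD hA hB) !(smulA hD hB hA).
rewrite !(smulA hB hD hA) !(smulA hA hD hB).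
by apply/funext => g; apply/funext => n; rewrite /sadd /sopp; ring.
Qed.

Lemma scommDl a b c A A' B : bounded a A -> bounded b A' -> bounded c B ->
  scomm lnq (sadd A A') B = sadd (scomm lnq A B) (scomm lnq A' B).
Proof.
move=> hA hA' hB; rewrite /scomm (smulDl hA hA' hB) (smulDr hB hA hA').
by apply/funext => g; apply/funext => n; rewrite /sadd /sopp; ring.
Qed.

Lemma scommC A B : scomm lnq A B = sopp (scomm lnq B A).
Proof.
by apply/funext => g; apply/funext => n; rewrite /scomm /sadd /sopp; ring.
Qed.

Local Notation cder F t d := (@is_derive C C^o C^o t 1 F d).
Local Notation nbhsC t0 := (nbhs (t0 : C^o)).

(** * Derivatives of families of symbols *)

Lemma cder_near0 (f : C -> C) (t0 d : C) :
  (\forall t \near (t0 : C^o), f t = 0) -> cder f t0 d -> d = 0.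
Proof.
move=> f0 df; apply: cder_unique df _; apply: cder_near (cder_cst 0 t0).
by apply: filterS f0 => t ->.
Qed.

(** A coefficient that vanishes for all t near t0 has zero derivative. *)
Lemma sderive_supp (A : C -> symbol) (t0 : C) (A' : symbol) S :
  sderive A t0 A' ->
  (forall g, \forall t \near (t0 : C^o), forall n, A t g n != 0 -> S g n) ->
  forall g n, A' g n != 0 -> S g n.
Proof.
move=> dA hS g n; apply: contraPP => nS; apply/negP; rewrite negbK; apply/eqP.
apply: cder_near0 (dA g n); apply: filterS (hS g) => t h.
by apply/eqP; apply/negP => /negP /h.
Qed.

Lemma bounded_sderive a (A : C -> symbol) (t0 : C) (A' : symbol) :
  ubounded (nbhsC t0) a A -> sderive A t0 A' -> bounded a A'.
Proof.
move=> [_ [S [hS AS]]] dA; have h := sderive_supp dA AS; split.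
  by move=> g n /h; exact: hS.1.
by move=> g; have [N hN] := hS.2 g; exists N => n /h; exact: hN.
Qed.

(** The Leibniz rule: near t0 each coefficient of the product is a sum over an
    index set independent of t. *)
Lemma sderive_smul a b (A B : C -> symbol) (t0 : C) (A' B' : symbol) :
  ubounded (nbhsC t0) a A -> ubounded (nbhsC t0) b B ->
  sderive A t0 A' -> sderive B t0 B' ->
  sderive (fun t => smul (A t) (B t)) t0
    (sadd (smul A' (B t0)) (smul (A t0) B')).
Proof.
move=> hA hB dA dB g n.
have [S [U [AS BU /(_ g n)[ps [ups hps ABE]]]]] := smul_near _ hA hB.
have A'S := sderive_supp dA AS; have B'U := sderive_supp dB BU.
have A0S b' i : A t0 b' i != 0 -> S b' i by apply: (nbhs_singleton (AS b')).
have B0U b' i : B t0 b' i != 0 -> U b' i by apply: (nbhs_singleton (BU b')).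
rewrite /sadd (smul_finite ups); last first.
  by move=> b' i /A'S h1 /B0U; exact: hps.
rewrite (smul_finite ups); last first.
  by move=> b' i /A0S h1 /B'U; exact: hps.
rewrite -big_split /=.
apply: (cder_near (F := fun t => \sum_(p <- ps) smul_term (A t) (B t) g n p)).
  by apply: filterS ABE => t ->.
apply: cder_sum => p; rewrite /smul_term.
exact: cderM (dA _ _) (cderZ _ (dB _ _)).
Qed.

Lemma sderive_const A (t0 : C) : sderive (fun=> A) t0 (@symb0 R).
Proof. by move=> g n; exact: cder_cst. Qed.

Lemma sderive_add (A B : C -> symbol) (t0 : C) (A' B' : symbol) :
  sderive A t0 A' -> sderive B t0 B' ->
  sderive (fun t => sadd (A t) (B t)) t0 (sadd A' B').
Proof. by move=> dA dB g n; exact: cderD. Qed.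

Lemma sderive_opp (A : C -> symbol) (t0 : C) (A' : symbol) :
  sderive A t0 A' -> sderive (fun t => sopp (A t)) t0 (sopp A').
Proof. by move=> dA g n; exact: cderN. Qed.

Lemma sderive_scomm a b (A B : C -> symbol) (t0 : C) (A' B' : symbol) :
  ubounded (nbhsC t0) a A -> ubounded (nbhsC t0) b B ->
  sderive A t0 A' -> sderive B t0 B' ->
  sderive (fun t => scomm lnq (A t) (B t)) t0
    (sadd (scomm lnq A' (B t0)) (scomm lnq (A t0) B')).
Proof.
move=> hA hB dA dB.
have := sderive_add (sderive_smul hA hB dA dB)
                    (sderive_opp (sderive_smul hB hA dB dA)).
congr sderive; apply/funext => g; apply/funext => n.
by rewrite /scomm /sadd /sopp; ring.
Qed.

Lemma sderive_unique (A : C -> symbol) (t0 : C) (V W : symbol) :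
  sderive A t0 V -> sderive A t0 W -> V = W.
Proof.
move=> dV dW; apply/funext => g; apply/funext => n.
exact: cder_unique (dV g n) (dW g n).
Qed.

Lemma sderive_near (A B : C -> symbol) (t0 : C) (V : symbol) :
  (\forall t \near (t0 : C^o), A t = B t) -> sderive A t0 V -> sderive B t0 V.
Proof.
move=> AB dA g n; apply: cder_near (dA g n).
by apply: filterS AB => t ->.
Qed.

(** Used for the class [sep] and for plain differentiability: any algebra of
    germs containing the coefficients of both factors contains those of the
    product. *)
Lemma smul_closed (T : Type) (F : set_system T) (FF : Filter F)
    (P : (T -> C) -> Prop) :
  (forall x, P (fun=> x)) ->
  (forall f g, P f -> P g -> P (fun t => f t + g t)) ->
  (forall f g, P f -> P g -> P (fun t => f t * g t)) ->
  (forall f g, P f -> (\forall t \near F, f t = g t) -> P g) ->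
  forall a b (A B : T -> symbol), ubounded F a A -> ubounded F b B ->
  (forall g n, P (fun t => A t g n)) -> (forall g n, P (fun t => B t g n)) ->
  forall g n, P (fun t => smul (A t) (B t) g n).
Proof.
move=> Pc PD PM Pn a b A B hA hB PA PB g n.
have [S [U [_ _ /(_ g n)[ps [_ _ ABE]]]]] := smul_near _ hA hB.
apply: (Pn (fun t => \sum_(p <- ps) smul_term (A t) (B t) g n p)); last first.
  by apply: filterS ABE => t ->.
elim: ps {ABE} => [|p ps IH].
  by under eq_fun do rewrite big_nil; exact: Pc.
under eq_fun do rewrite big_cons; apply: PD IH.
exact: (PM _ _ (PA _ _) (PM _ _ (Pc _) (PB _ _))).
Qed.

(** * The filtration by degree *)

Definition degree_le (a : C) (A : symbol) : Prop :=
  forall g n, A g n != 0 -> below a g.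

Lemma degree_le_eq0 a A g : degree_le a A -> ~ below a g -> A g = (fun=> 0).
Proof.
move=> hA ng; apply/funext => n; apply/eqP; apply/negP => /negP h.
exact/ng/(hA g n).
Qed.

Lemma degree_le_smul a b A B :
  degree_le a A -> degree_le b B -> degree_le (a + b) (smul A B).
Proof.
move=> hA hB g n /smul_neq0[x [i [/hA h1 /hB h2]]].
by rewrite -[g](subrKC x); exact: belowD.
Qed.

(** Equality modulo the degrees in a - N: the filtration for which the recursions
    below converge. *)
Definition agree (a : C) (A B : symbol) : Prop :=
  forall g, ~ below a g -> A g = B g.

Lemma agree_sym a A B : agree a A B -> agree a B A.
Proof. by move=> h g /h ->. Qed.

Lemma agree_trans a A B D : agree a A B -> agree a B D -> agree a A D.
Proof. by move=> h k g ng; rewrite h // k. Qed.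

Lemma belowB a (i j : nat) : below (a - i%:R) (a - j%:R) <-> (i <= j)%N.
Proof.
split=> [[k /eqP]|ij].
  rewrite -addrA -opprD -natrD (can_eq (addKr a)) eqr_opp eqr_nat => /eqP ->.
  exact: leq_addr.
by exists (j - i)%N; rewrite natrB //; ring.
Qed.

Lemma agree_weaken a (i j : nat) A B : (i <= j)%N ->
  agree (a - j%:R) A B -> agree (a - i%:R) A B.
Proof.
move=> ij h g ng; apply: h => hg; apply: ng; move: hg => [k ->].
by exists (j - i + k)%N; rewrite natrD natrB //; ring.
Qed.

(** Errors of relative order k in the factors give an error of relative order k
    in the product: the product is continuous for the filtration. *)
Lemma smul_agree a b (k : nat) A A' B B' :
  degree_le a A -> degree_le a A' -> degree_le b B -> degree_le b B' ->
  agree (a - k%:R) A A' -> agree (b - k%:R) B B' ->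
  agree (a + b - k%:R) (smul A B) (smul A' B').
Proof.
move=> hA hA' hB hB' AA' BB' g ng; apply/funext => n.
apply: eq_fsbigr => x _; congr (_ n).
have [ax|nax] := pselect (below a x); last first.
  by rewrite !(degree_le_eq0 _ nax) // !lmul0l.
have [bx|nbx] := pselect (below b (g - x)); last first.
  have z : hhat lnq x (fun=> 0) = (fun=> 0) :> @laurent R.
    by apply/funext => m; rewrite /hhat mulr0.
  rewrite !(degree_le_eq0 _ nbx) // z.
  by apply/funext => m; rewrite /lmul !fsbig1 // => *; rewrite mulr0.
rewrite AA'; last first.
  move=> hx; apply: ng; rewrite addrAC -[g](subrKC x); exact: belowD.
rewrite BB' //.
move=> hx; apply: ng; rewrite -addrA -[g](subrKC x); exact: belowD.
Qed.

Lemma smul_agreel a b (k : nat) A A' B :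
  degree_le a A -> degree_le a A' -> degree_le b B ->
  agree (a - k%:R) A A' -> agree (a + b - k%:R) (smul A B) (smul A' B).
Proof. by move=> hA hA' hB h; apply: smul_agree. Qed.

Lemma degree_le_sigma a t X : degree_le a X -> degree_le a (sigma lnq t X).
Proof.
by move=> hX g n; rewrite sigmaE mulf_eq0 negb_or => /andP[_ /hX].
Qed.

Lemma degree_le_Dpow t : degree_le t (Dpow t).
Proof. exact: (bounded_Dpow t).1. Qed.

Lemma bounded_sigma a t X : bounded a X -> bounded a (sigma lnq t X).
Proof.
by move=> hX; apply: (bounded_sub hX) => g n; rewrite sigmaE mulf_eq0 negb_or => /andP[].
Qed.

Lemma prim_zero : prim (fun=> 0 : C) = (fun=> 0).
Proof. by apply: primE => // t; exact: cder_cst. Qed.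

(** * The exponential of X + ln D *)

(** The Picard iteration for A = 1 + (integral from 0 to s of A sigma_u(X) du).
    Since X has degree -1, each step makes one more degree final. *)
Fixpoint picard (X : symbol) (k : nat) : C -> symbol :=
  if k is k'.+1 then
    fun s g n => Dpow 0 g n +
      prim (fun u => smul (picard X k' u) (sigma lnq u X) g n) s
  else fun=> Dpow 0.

(** The k with g = -k.  The default 0 is harmless: where it applies, all the
    iterates vanish. *)
Definition depth (g : C) : nat := xget 0%N [set k : nat | g = - k%:R].

Lemma depthN (k : nat) : depth (- k%:R) = k.
Proof.
apply: (xget_unique 0%N) => // j /eqP; rewrite eqr_opp eqr_nat => /eqP //.
Qed.

(** The factor A(s) of exp s(X + ln D) = A(s) D^s, as the limit of the Picard
    iteration: the coefficient of D^-k is final after k steps. *)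
Definition sexp (X : symbol) (s : C) : symbol := fun g => picard X (depth g) s g.

Lemma below0N g : below 0 g -> exists k : nat, g = - k%:R.
Proof. by move=> [k ->]; exists k; rewrite sub0r. Qed.

Lemma limit_agree (F : nat -> symbol) : (forall k, degree_le 0 (F k)) ->
  (forall k, agree (0 - k.+1%:R) (F k) (F k.+1)) ->
  forall k, agree (0 - k.+1%:R) (fun g => F (depth g) g) (F k).
Proof.
move=> dF step.
have stable j k : (j <= k)%N -> agree (0 - j.+1%:R) (F j) (F k).
  elim: k => [|k IH]; first by rewrite leqn0 => /eqP ->.
  rewrite leq_eqVlt ltnS => /predU1P[-> //|jk]; apply: (agree_trans (IH jk)).
  by apply: (agree_weaken (j := k.+1)) => //; exact: step.
move=> k g ng; have [/below0N[j gj]|n0] := pselect (below 0 g); last first.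
  by rewrite !(degree_le_eq0 (dF _) n0).
rewrite gj depthN; apply: stable.
  rewrite leqNgt; apply/negP => kj; apply: ng.
  by rewrite gj -[- j%:R]sub0r; apply/belowB.
by rewrite -[- j%:R]sub0r => /belowB; rewrite ltnn.
Qed.

Lemma degree_le_picard X k s : degree_le (-1) X -> degree_le 0 (picard X k s).
Proof.
move=> hX; elim: k s => [|k IH] s; first exact: degree_le_Dpow.
move=> g n; apply: contraPP => ng; apply/negP; rewrite negbK; apply/eqP.
rewrite /= (degree_le_eq0 (@degree_le_Dpow 0)) // add0r.
have -> : (fun u => smul (picard X k u) (sigma lnq u X) g n) = (fun=> 0).
  apply/funext => u.
  rewrite (degree_le_eq0 (degree_le_smul (IH u) (degree_le_sigma hX))) //.
  move=> h; apply: ng; move: (below_weaken 1 h); congr below; ring.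
by rewrite prim_zero.
Qed.

Lemma degree_le_sexp X s : degree_le (-1) X -> degree_le 0 (sexp X s).
Proof. by move=> hX g n; exact: degree_le_picard. Qed.

Lemma picard_step X k s : degree_le (-1) X ->
  agree (0 - k.+1%:R) (picard X k s) (picard X k.+1 s).
Proof.
move=> hX; elim: k s => [|k IH] s g ng; apply/funext => n; rewrite [RHS]/=.
  have -> : (fun u => smul (Dpow 0) (sigma lnq u X) g n) = (fun=> 0).
    apply/funext => u; rewrite Dpow0_smul (degree_le_eq0 (degree_le_sigma hX)) //.
    by rewrite -sub0r.
  by rewrite prim_zero addr0.
rewrite [LHS]/=; congr (_ + prim _ s); apply/funext => u; congr (_ n).
apply: (smul_agreel (a := 0) (b := -1) (k := k.+1)) => //.
- exact: (degree_le_picard (k := k) hX).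
- exact: (degree_le_picard (k := k.+1) hX).
- exact: degree_le_sigma.
by move=> h; apply: ng; move: h; congr below; rewrite -[k.+2]addn1 natrD; ring.
Qed.

Lemma sexp_picard X k s : degree_le (-1) X ->
  agree (0 - k.+1%:R) (sexp X s) (picard X k s).
Proof.
move=> hX; apply: (limit_agree (F := fun k => picard X k s)).
  by move=> j; exact: degree_le_picard.
by move=> j; exact: picard_step.
Qed.

(** * Families depending on a parameter and on the exponent *)

(** For t near t0 and for all exponents s at once. *)
Definition param_filter (t0 : C) : set_system (C * C) :=
  [set U : set (C * C) | \forall t \near (t0 : C^o), forall s, U (t, s)].

Global Instance param_filter_filter t0 : Filter (param_filter t0).
Proof.
split; rewrite /param_filter /=.
- exact: near_all.
- move=> P Q hP hQ; apply: (@filterS2 _ (nbhsC t0) _ _ _ _ _ hP hQ) => t hPt hQt s.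
  by split; [exact: hPt|exact: hQt].
- by move=> P Q PQ; apply: (@filterS _ (nbhsC t0)) => t h s; exact: PQ.
Qed.

(** Families A(t, s) with differentiable dependence on t, stable under all the
    operations that build exp s(X + ln D).  A single symbol is a constant
    family, so the results for one symbol are special cases. *)
Definition regular (t0 a : C) (A : C -> C -> symbol) : Prop :=
  ubounded (param_filter t0) a (fun p => A p.1 p.2) /\
  forall g n, sep t0 (fun t s => A t s g n).

Lemma regular_const t0 a A : bounded a A -> regular t0 a (fun _ _ => A).
Proof. by move=> hA; split; [exact: bounded_ubounded|move=> *; exact: sep_cst]. Qed.

Lemma regular_param t0 a (A : C -> symbol) : ubounded (nbhsC t0) a A ->
  (forall g n, exists d, cder (fun t => A t g n) t0 d) ->
  regular t0 a (fun t _ => A t).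
Proof.
move=> [hA [S [hS AS]]] dA; split; last first.
  by move=> g n; have [d h] := dA g n; exact: sep_param h.
split; first by apply: filterS hA => t h s.
by exists S; split=> // g; apply: filterS (AS g) => t h s.
Qed.

Lemma regular_smul t0 a b A B : regular t0 a A -> regular t0 b B ->
  regular t0 (a + b) (fun t s => smul (A t s) (B t s)).
Proof.
move=> [hA sA] [hB sB]; split; first exact: ubounded_smul hA hB.
pose P (f : C * C -> C) := sep t0 (fun t s => f (t, s)).
apply: (@smul_closed _ (param_filter t0) _ P _ _ _ _ a b (fun p => A p.1 p.2) (fun p => B p.1 p.2)) => //.
- by move=> x; exact: sep_cst.
- by move=> f g; exact: sepD.
- by move=> f g; exact: sepM.
- by move=> f g sf fg; apply: sep_near sf _; exact: fg.
Qed.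

Lemma regular_sigma t0 a A : regular t0 a A ->
  regular t0 a (fun t s => sigma lnq s (A t s)).
Proof.
move=> [hA sA]; split.
  apply: ubounded_sub hA _; apply: filterE => -[t s] g n.
  by rewrite sigmaE mulf_eq0 negb_or => /andP[].
move=> g n; apply: sep_eq (sepM (sep_exp t0 (lnq * n%:~R)) (sA g n)) _ => t s.
by rewrite sigmaE qpow_expz.
Qed.

Lemma regular_add t0 a A B : regular t0 a A -> regular t0 a B ->
  regular t0 a (fun t s => sadd (A t s) (B t s)).
Proof.
move=> [hA sA] [hB sB]; split; first exact: ubounded_add.
by move=> g n; exact: sepD.
Qed.

Lemma regular_opp t0 a A : regular t0 a A ->
  regular t0 a (fun t s => sopp (A t s)).
Proof.
move=> [hA sA]; split; first exact: ubounded_opp.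
by move=> g n; exact: sepN.
Qed.

Lemma regular_prim t0 a A : regular t0 a A ->
  regular t0 a (fun t s g n => prim (fun u => A t u g n) s).
Proof.
move=> [[hA [S [hS AS]]] sA]; split; last by move=> g n; exact: sep_prim.
have p0 t g n s : (forall u, A t u g n = 0) -> prim (fun u => A t u g n) s = 0.
  by move=> h; rewrite (funext h) prim_zero.
split.
  apply: (@filterS _ (nbhsC t0) _ _ _ _ hA) => t h s g n; apply: contraPP => ng.
  apply/negP; rewrite negbK; apply/eqP; apply: p0 => u.
  by apply/eqP; apply/negP => /negP /(h u g n).
exists S; split=> // g; apply: (@filterS _ (nbhsC t0) _ _ _ _ (AS g)) => t h s n; apply: contraPP => ng.
apply/negP; rewrite negbK; apply/eqP; apply: p0 => u.
by apply/eqP; apply/negP => /negP /(h u n).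
Qed.

Lemma regular_weaken t0 a (i : nat) A : regular t0 a A -> regular t0 (a + i%:R) A.
Proof. by move=> [hA sA]; split=> //; exact: ubounded_weaken. Qed.

Lemma regular_picard t0 (X : C -> symbol) k : regular t0 (-1) (fun t _ => X t) ->
  regular t0 0 (fun t => picard (X t) k).
Proof.
move=> hX; elim: k => [|k IH] /=; first exact: regular_const (bounded_Dpow 0).
have h := regular_prim (regular_smul IH (regular_sigma hX)).
have := regular_weaken 1 h; rewrite add0r [-1 + _]addrC subrr.
exact: regular_add (regular_const t0 (bounded_Dpow 0)).
Qed.

Lemma regular_degree t0 a (X : C -> symbol) : regular t0 a (fun t _ => X t) ->
  \forall t \near (t0 : C^o), degree_le a (X t).
Proof. by move=> [[h _] _]; apply: (@filterS _ (nbhsC t0) _ _ _ _ h) => t /(_ 0). Qed.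

Lemma regular_sexp t0 (X : C -> symbol) : regular t0 (-1) (fun t _ => X t) ->
  regular t0 0 (fun t => sexp (X t)).
Proof.
move=> hX; have hp k := regular_picard k hX; split; last first.
  by move=> g n; exact: (hp (depth g)).2.
split.
  by apply: filterS (regular_degree hX) => t h s; exact: degree_le_sexp.
have /choice[S hS] : forall k, exists S, bounded_supp 0 S /\
    forall g, \forall p \near param_filter t0, forall n,
      picard (X p.1) k p.2 g n != 0 -> S g n.
  by move=> k; case: (hp k) => -[_ h] _.
exists (fun g => S (depth g) g); split.
  split=> [g n|g]; first by have [h _] := (hS (depth g)).1; exact: h.
  by have [_ h] := (hS (depth g)).1; exact: h.
by move=> g; exact: (hS (depth g)).2.
Qed.

Lemma cder_picard X k g n s : bounded (-1) X ->
  cder (fun s => picard X k.+1 s g n) s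
       (smul (picard X k s) (sigma lnq s X) g n).
Proof.
move=> hX; have hR := regular_const 0 hX.
have [_ sP] := regular_smul (regular_picard k hR) (regular_sigma hR).
have /nbhs_singleton dP := cder_prim (sP g n).
by apply: cder_eq (cderD (cder_cst _ s) (dP s)) _; rewrite add0r.
Qed.

Lemma exists_not_below g : exists k : nat, ~ below (0 - k%:R) g.
Proof.
have [/below0N[j ->]|n0] := pselect (below 0 g); last first.
  by exists 0%N; rewrite subr0.
by exists j.+1; rewrite -[- j%:R]sub0r => /belowB; rewrite ltnn.
Qed.

Lemma sderive_sexp X s : bounded (-1) X ->
  sderive (sexp X) s (smul (sexp X s) (sigma lnq s X)).
Proof.
move=> hX g n; have [k ng] := exists_not_below g.
have dX := hX.1; have dP := degree_le_picard dX; have dS := degree_le_sexp dX.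
have ng' (j : nat) : ~ below (0 - (k + j)%:R) g.
  by move=> h; apply: ng; move: (below_weaken j h); congr below; rewrite natrD; ring.
have -> : smul (sexp X s) (sigma lnq s X) g = smul (picard X k s) (sigma lnq s X) g.
  apply: (smul_agreel (a := 0) (b := -1) (k := k.+1)) => //.
  - exact: degree_le_sigma.
  - exact: sexp_picard.
  - by move: (ng' 2); congr (~ below _ _); rewrite -[k.+1]addn1 !natrD; ring.
apply: (cder_near (F := fun u => picard X k.+1 u g n)); last exact: cder_picard.
apply: near_all => u; rewrite (sexp_picard u dX (k := k.+1)) //.
by move: (ng' 2); rewrite addn2.
Qed.

(** In degree -k the right-hand side involves A only in degrees above -k, where
    the two curves already agree. *)
Lemma ode_unique X (A B : C -> symbol) : degree_le (-1) X ->
  (forall t, degree_le 0 (A t)) -> (forall t, degree_le 0 (B t)) -> A 0 = B 0 ->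
  (forall t, sderive A t (smul (A t) (sigma lnq t X))) ->
  (forall t, sderive B t (smul (B t) (sigma lnq t X))) -> A = B.
Proof.
move=> hX hA hB AB0 dA dB.
have AB k t : agree (0 - k%:R) (A t) (B t).
  elim: k t => [|k IH] t g ng.
    rewrite subr0 in ng.
    by rewrite (degree_le_eq0 (hA t) ng) (degree_le_eq0 (hB t) ng).
  apply/funext => n; apply: (cder_eq_on (F := fun t => A t g n) (G := fun t => B t g n)).
  - exact: (fun t => dA t g n).
  - move=> u; apply: cder_eq (dB u g n) _; congr (_ n).
    apply: (smul_agreel (a := 0) (b := -1) (k := k)) => //.
    + exact: degree_le_sigma.
    + exact: agree_sym.
    + by move=> h; apply: ng; move: h; congr below; rewrite -[k.+1]addn1 natrD; ring.
  - by rewrite AB0.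
apply/funext => t; apply/funext => g.
by have [k ng] := exists_not_below g; exact: AB ng.
Qed.

Lemma sexp0 X : sexp X 0 = Dpow 0.
Proof.
apply/funext => g; rewrite /sexp; case: (depth g) => [|k] //=.
by apply/funext => n; rewrite prim0 addr0.
Qed.

Lemma regular_slice t0 a A : regular t0 a A ->
  forall F : set_system C, Filter F -> ubounded F a (A t0).
Proof.
move=> [[hA [S [hS AS]]] _] F FF; split.
  by apply: filterE => s; exact: (nbhs_singleton hA).
by exists S; split=> // g; apply: filterE => s; exact: (nbhs_singleton (AS g)).
Qed.

Lemma ubounded_sexp X (F : set_system C) : bounded (-1) X -> Filter F ->
  ubounded F 0 (sexp X).
Proof. by move=> hX; exact: (regular_slice (regular_sexp (regular_const 0 hX))). Qed.

Lemma bounded_sexp X s : bounded (-1) X -> bounded 0 (sexp X s).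
Proof.
move=> hX; apply: (ubounded_at _ (ubounded_sexp hX (nbhs_filter (s : C^o)))).
by move=> P; exact: nbhs_singleton.
Qed.

Lemma sexp_lead X s n : degree_le (-1) X -> sexp X s 0 n = (n == 0)%:R.
Proof.
move=> hX; rewrite (sexp_picard (k := 0) s hX).
  by rewrite /= /Dpow eqxx.
move=> h; have /belowB : below (0 - 1%:R) (0 - 0%:R) by rewrite subr0.
by [].
Qed.

Lemma bounded_Jminus X : bounded (-1) X <-> Jminus X.
Proof.
split=> [hX|[[lX _] dX]].
  have lX g : is_laurent (X g).
    have [N hN] := hX.2 g; exists N => n Nn; apply/eqP; apply/negP => /negP /hN.
    by rewrite leNgt Nn.
  have dX g n : X g n != 0 -> exists i : nat, g = - i.+1%:R.
    by move=> /hX.1[i ->]; exists i; rewrite -natr1; ring.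
  split=> //; split=> //; exists 0 => g n /dX[i ->]; exists (- i.+1%:Z).
  by rewrite mulrNz.
split=> [g n /dX[i ->]|g]; first by exists i; rewrite -natr1; ring.
have [N hN] := lX g; exists N => n; apply: contraR; rewrite -ltNge => /hN ->.
by rewrite eqxx.
Qed.

Lemma Ghat_bounded a L : Ghat a L <-> bounded a L /\ forall n, L a n = (n == 0)%:R.
Proof.
split=> [[lL lead dL]|[hL lead]].
  split=> //; split=> // g; have [N hN] := lL g; exists N => n.
  by apply: contraR; rewrite -ltNge => /hN ->; rewrite eqxx.
split=> //; last exact: hL.1.
move=> g; have [N hN] := hL.2 g; exists N => n Nn.
by apply/eqP; apply/negP => /negP /hN; rewrite leNgt Nn.
Qed.

Lemma exp_ode_sexp X : bounded (-1) X -> exp_ode lnq X (sexp X).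
Proof.
move=> hX; split; first 1 last.
- exact: sexp0.
- by move=> t; exact: sderive_sexp.
move=> t; apply/Ghat_bounded; split; first exact: bounded_sexp.
by move=> n; apply: sexp_lead; exact: hX.1.
Qed.

Lemma exp_ode_unique X A : bounded (-1) X -> exp_ode lnq X A -> A = sexp X.
Proof.
move=> hX [GA A0 dA]; apply: (ode_unique hX.1) => //.
- by move=> t; have /Ghat_bounded[[]] := GA t.
- by move=> t; exact: degree_le_sexp hX.1.
- by rewrite sexp0.
- by move=> t; exact: sderive_sexp.
Qed.

Lemma exp_solE X : bounded (-1) X -> exp_sol lnq X = sexp X.
Proof.
move=> hX; apply: xget_unique; first exact: exp_ode_sexp.
by move=> A; exact: exp_ode_unique.
Qed.

Lemma sderive_shift (A : C -> symbol) t s V :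
  sderive A (t + s) V -> sderive (fun u => A (t + u)) s V.
Proof.
move=> dA g n; apply/is_deriveP_eps => e e0.
move/is_deriveP_eps: (dA g n) => /(_ e e0); apply: filterS => h.
by rewrite addrA.
Qed.

Lemma sigmaM a b t A B : bounded a A -> bounded b B ->
  sigma lnq t (smul A B) = smul (sigma lnq t A) (sigma lnq t B).
Proof.
move=> hA hB; have D := bounded_Dpow.
rewrite /sigma (smulA (bounded_smul (D t) hA) (D (- t)) (bounded_smul (bounded_smul (D t) hB) (D (-t)))).
rewrite -(smulA (D (- t)) (bounded_smul (D t) hB) (D (-t))).
rewrite -(smulA (D (- t)) (D t) hB) smul_Dpow addNr Dpow0_smul.
rewrite -(smulA (bounded_smul (D t) hA) hB (D (-t))).
by rewrite (smulA (D t) hA hB).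
Qed.

Lemma sigma_sigma s t A : sigma lnq s (sigma lnq t A) = sigma lnq (t + s) A.
Proof.
by apply/funext => g; apply/funext => n; rewrite !sigmaE [t + s]addrC (qpowDz s t) mulrA.
Qed.

Lemma sigma_Dpow t s : sigma lnq t (Dpow s) = Dpow s.
Proof. by rewrite /sigma !smul_Dpow addrAC subrr add0r. Qed.

Lemma smul0l A : smul (@symb0 R) A = @symb0 R.
Proof.
apply/funext => g; apply/funext => n; apply: fsbig1 => b _.
by apply: fsbig1 => i _; rewrite mul0r.
Qed.

Lemma sderive_smull a b A (B : C -> symbol) t0 B' : bounded a A ->
  ubounded (nbhsC t0) b B -> sderive B t0 B' ->
  sderive (fun t => smul A (B t)) t0 (smul A B').
Proof.
move=> hA hB dB.
have := sderive_smul (bounded_ubounded (nbhs_filter (t0 : C^o)) hA) hB (sderive_const A t0) dB.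
by rewrite smul0l; congr sderive; apply/funext => g; apply/funext => n; rewrite /sadd add0r.
Qed.

Lemma sderive_sigma t (B : C -> symbol) t0 B' : sderive B t0 B' ->
  sderive (fun u => sigma lnq t (B u)) t0 (sigma lnq t B').
Proof.
move=> dB g n; rewrite sigmaE; under eq_fun do rewrite sigmaE.
exact: cderZ (dB g n).
Qed.

Lemma ubounded_sigma (T : Type) (F : set_system T) (FF : Filter F) a t
    (A : T -> symbol) :
  ubounded F a A -> ubounded F a (fun u => sigma lnq t (A u)).
Proof.
move=> hA; apply: (ubounded_sub _ hA); apply: filterE => u g n.
by rewrite sigmaE mulf_eq0 negb_or => /andP[].
Qed.

(** As functions of s, both sides solve B' = B sigma_s(sigma_t(X)) with the same
    value at s = 0. *)
Lemma sexpD X t s : bounded (-1) X ->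
  smul (sexp X t) (sigma lnq t (sexp X s)) = sexp X (t + s).
Proof.
move=> hX.
have hE u := bounded_sexp u hX.
pose B u := smul (sexp X t) (sigma lnq t (sexp X u)).
have hB u : bounded (0 + 0) (B u) := bounded_smul (hE t) (bounded_sigma t (hE u)).
suff : B = (fun u => sexp X (t + u)) by move=> /(congr1 (@^~ s)).
apply: (ode_unique (X := sigma lnq t X)).
- exact: degree_le_sigma hX.1.
- by move=> u; have := (hB u).1; rewrite addr0.
- by move=> u; exact: degree_le_sexp hX.1.
- by rewrite /B sexp0 sigma_Dpow smul_Dpow0 addr0.
- move=> u; rewrite /B sigma_sigma.
  have -> : smul (smul (sexp X t) (sigma lnq t (sexp X u))) (sigma lnq (t + u) X) =
    smul (sexp X t) (sigma lnq t (smul (sexp X u) (sigma lnq u X))).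
    rewrite (smulA (hE t) (bounded_sigma t (hE u)) (bounded_sigma (t + u) hX)).
    rewrite (sigmaM t (hE u) (bounded_sigma u hX)).
    by rewrite sigma_sigma [u + t]addrC.
  apply: (sderive_smull (hE t)).
    exact: ubounded_sigma (ubounded_sexp hX (nbhs_filter (u : C^o))).
  by apply: sderive_sigma; exact: sderive_sexp.
- move=> u; rewrite sigma_sigma; apply: sderive_shift; exact: sderive_sexp.
Qed.

(** * Genericity *)

(** Once e^x = 1, reduce y modulo 2 pi to [0, 2 pi): there sin vanishes only at
    0 and pi, and cos pi = -1. *)
Lemma cexp_eq1 (z : C) : cexp z = 1 -> exists k : int, z = k%:~R * (2 * pi%:C * 'i).
Proof.
case: z => x y /eqP; rewrite eq_complex /= => /andP[/eqP hc /eqP hs].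
have ex : expR x = 1.
  have e0 := expR_gt0 x.
  have : expR x ^+ 2 = 1.
    transitivity ((expR x * cos y) ^+ 2 + (expR x * sin y) ^+ 2).
      by rewrite !exprMn -mulrDr cos2Dsin2 mulr1.
    by rewrite hc hs expr1n expr0n addr0.
  by move=> /eqP; rewrite sqrf_eq1 => /orP[/eqP//|/eqP h]; move: e0; rewrite h; lra.
move: hc hs; rewrite ex !mul1r => hc hs.
have x0 : x = 0 by rewrite -(expRK x) ex ln1.
(* r is the representative of y modulo 2 pi in [0, 2 pi) *)
pose k := Num.floor (y / (pi *+ 2)).
have pi0 : 0 < pi *+ 2 :> R by rewrite mulrn_wgt0 // pi_gt0.
pose r := y - pi *+ 2 * k%:~R.
have r0 : 0 <= r by rewrite subr_ge0 mulrC -ler_pdivlMr // floor_le.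
have r2 : r < pi *+ 2.
  rewrite ltrBlDl -{2}[pi *+ 2]mulr1 -mulrDr mulrC -ltr_pdivrMr //.
  by have := floorD1_gt (y / (pi *+ 2)); rewrite intrD.
have per (f : R -> R) : periodic f (pi *+ 2) -> f r = f y.
  move=> pf; rewrite /r; case: (k) => m.
    by rewrite -[in RHS](subrK (pi *+ 2 * m%:~R) y) mulr_natr (periodicn pf).
  rewrite NegzE mulrNz mulrN opprK -[in RHS](periodicn pf m.+1) mulr_natr.
  by [].
have cr : cos r = 1 by rewrite (per _ (@cosD2pi R)).
have sr : sin r = 0 by rewrite (per _ (@sinD2pi R)).
have rE : r = 0.
  apply/eqP; rewrite eq_le r0 andbT leNgt; apply/negP => rp.
  have [rpi|pir|rpi] := ltgtP r pi.
  - by have := @sin_gt0_pi R r; rewrite rp rpi sr ltxx => /(_ isT).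
  - have := @sin_gt0_pi R (r - pi).
    have -> : sin (r - pi) = 0.
      by apply/eqP; rewrite -oppr_eq0 -[r - pi]/(r - pi) -(sinDpi (r - pi)) subrK sr.
    rewrite ltxx subr_gt0 pir ltrBlDr -mulr2n r2 => /(_ isT); by [].
  - by move: cr; rewrite rpi cospi => h; exfalso; lra.
exists k; apply/eqP; rewrite eq_complex x0 /=.
have yE : y = pi *+ 2 * k%:~R by apply/eqP; rewrite -subr_eq0 -/r rE.
have -> : (k%:~R : C) = (k%:~R)%:C by rewrite rmorph_int.
by rewrite yE /= -mulr_natl; apply/andP; split; apply/eqP; ring.
Qed.

Lemma twopii_neq0 : 2 * pi%:C * 'i != 0 :> C.
Proof.
rewrite !mulf_neq0 ?pnatr_eq0 //; last by rewrite eq_complex /= oner_eq0 andbF.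
by rewrite eq_complex /= eqxx andbT gt_eqF // pi_gt0.
Qed.

Lemma generic_neq0 a : generic lnq a -> a * lnq != 0.
Proof.
by move=> ga; apply/eqP => h; apply: (ga 0); rewrite h mul0r rmorph0.
Qed.

Lemma generic_qpow a (n : int) : generic lnq a -> n != 0 -> qpow a ^ n != 1.
Proof.
move=> ga n0; apply/eqP; rewrite qpow_expz => /cexp_eq1[k hk].
apply: (ga (k%:~R / n%:~R)).
have n0' : n%:~R != 0 :> C by rewrite intr_eq0.
rewrite fmorph_div !rmorph_int.
apply/eqP; rewrite (can2_eq (divfK twopii_neq0) (mulfK twopii_neq0)).
apply/eqP; rewrite mulrAC -hk; move: n0'; set N := n%:~R => n0'.
by rewrite [lnq * N * a]mulrAC mulfK // mulrC.
Qed.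

(** The factor by which the coefficient of z^n D^-k in X enters that of
    exp s(X + ln D) to first order, see [sexp_linear]. *)
Definition phi (n : int) (s : C) : C := prim (fun u => qpow u ^ n) s.

Lemma cder_phi n s : cder (phi n) s (qpow s ^ n).
Proof.
have sF : sep 0 (fun _ u => qpow u ^ n).
  by apply: sep_eq (sep_exp 0 (lnq * n%:~R)) _ => t s'; rewrite qpow_expz.
exact: (nbhs_singleton (cder_prim sF)).
Qed.

(** phi n a is a for n = 0 and (q^(an) - 1) / (n ln q) otherwise. *)
Lemma phi_neq0 a n : generic lnq a -> phi n a != 0.
Proof.
move=> ga; have := generic_neq0 ga; rewrite mulf_eq0 negb_or => /andP[a0 l0].
have [->|n0] := eqVneq n 0.
  rewrite /phi (@primE _ _ id) // => t; rewrite expr0z; exact: cder_id.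
pose c := lnq * n%:~R; have c0 : c != 0 by rewrite mulf_neq0 // intr_eq0.
have -> : phi n = (fun u => c^-1 * cexp (c * u) - c^-1).
  apply: primE; first by rewrite mulr0 cexp0 mulr1 subrr.
  move=> t; rewrite qpow_expz.
  apply: (cder_eq (cderB (cderZ _ (cder_exp c t)) (cder_cst _ _))).
  by rewrite mulKf // subr0.
rewrite -[X in _ - X]mulr1 -mulrBr mulf_neq0 ?invr_eq0 // subr_eq0.
by rewrite -qpow_expz; exact: generic_qpow.
Qed.

(** * The logarithm *)

Lemma bounded_lead0 a A : bounded a A -> A a = (fun=> 0) -> bounded (a - 1) A.
Proof.
move=> hA A0; split; last exact: hA.2.
move=> g n h; have [[|i] gi] := hA.1 g n h.
  by move: h; rewrite gi subr0 A0 eqxx.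
by exists i; rewrite gi -[i.+1]add1n natrD; ring.
Qed.

Lemma Ghat_subDpow a L : Ghat a L -> bounded (a - 1) (sadd L (sopp (Dpow a))).
Proof.
move=> /Ghat_bounded[hL lead]; apply: bounded_lead0.
  exact: bounded_add (bounded_opp (bounded_Dpow a)).
by apply/funext => n; rewrite /sadd /sopp lead /Dpow eqxx subrr.
Qed.

Lemma Ghat_sexp X s : bounded (-1) X -> Ghat 0 (sexp X s).
Proof. by move=> /exp_ode_sexp[]. Qed.

Lemma agree_sigma a s X X' : agree a X X' -> agree a (sigma lnq s X) (sigma lnq s X').
Proof. by move=> XX' g ng; apply/funext => n; rewrite !sigmaE XX'. Qed.

Lemma sexp_agree X X' (k : nat) s : bounded (-1) X -> bounded (-1) X' ->
  agree (0 - k%:R) X X' -> agree (0 - k%:R) (sexp X s) (sexp X' s).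
Proof.
move=> hX hX' XX'.
suff : forall j, (j <= k)%N -> forall u, agree (0 - j%:R) (sexp X u) (sexp X' u).
  exact.
elim=> [|j IH] jk u g ng.
  rewrite subr0 in ng.
  by rewrite !(degree_le_eq0 (degree_le_sexp _) ng) //; [exact: hX'.1|exact: hX.1].
apply/funext => n.
apply: (cder_eq_on (F := fun t => sexp X t g n) (G := fun t => sexp X' t g n)).
- exact: (fun t => sderive_sexp t hX g n).
- move=> t; apply: cder_eq (sderive_sexp t hX' g n) _; congr (_ n).
  apply: (smul_agree (a := 0) (b := -1) (k := j)) => //.
  + exact: degree_le_sexp hX'.1.
  + exact: degree_le_sexp hX.1.
  + exact: degree_le_sigma hX'.1.
  + exact: degree_le_sigma hX.1.
  + by apply: agree_sym; apply: IH; exact: ltnW.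
  + apply: agree_sigma; apply: agree_sym.
    have -> : -1 - j%:R = 0 - j.+1%:R :> C by rewrite -[j.+1]addn1 natrD; ring.
    exact: agree_weaken jk XX'.
  + by move=> h; apply: ng; move: h; congr below; rewrite -[j.+1]addn1 natrD; ring.
- by rewrite !sexp0.
Qed.

(** In the highest degree where X and X' differ the exponential is affine:
    A sigma(X) = sigma(X) + (A - 1) sigma(X), and A - 1 has degree -1, so that
    the last term does not see the difference in this degree. *)
Lemma sexp_linear X X' (k : nat) s n : bounded (-1) X -> bounded (-1) X' ->
  agree (0 - k.+1%:R) X X' ->
  sexp X' s (- k.+1%:R) n - sexp X s (- k.+1%:R) n =
    phi n s * (X' (- k.+1%:R) n - X (- k.+1%:R) n).
Proof.
move=> hX hX' XX'; set g := - k.+1%:R.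
pose d := X' g n - X g n.
have eqk : 0 - k.+1%:R = -1 - k%:R :> C by rewrite -[k.+1]addn1 natrD; ring.
apply: (cder_eq_on (F := fun s => sexp X' s g n - sexp X s g n)
   (G := fun s => phi n s * d)).
- move=> t; exact: cderB (sderive_sexp t hX' g n) (sderive_sexp t hX g n).
- move=> t; apply: (cder_eq (cderM (cder_phi n t) (cder_cst d t))).
  rewrite mulr0 addr0.
  pose minus1 Z := sadd (sexp Z t) (sopp (Dpow 0)).
  have hm Z : bounded (-1) Z -> bounded (-1) (minus1 Z).
    by move=> hZ; have := Ghat_subDpow (Ghat_sexp t hZ); rewrite sub0r.
  have split1 Z : bounded (-1) Z -> smul (sexp Z t) (sigma lnq t Z) g n =
      qpow t ^ n * Z g n + smul (minus1 Z) (sigma lnq t Z) g n.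
    move=> hZ; have -> : sexp Z t = sadd (Dpow 0) (minus1 Z).
      by apply/funext => x; apply/funext => m; rewrite /minus1 /sadd /sopp subrKC.
    rewrite (smulDl (bounded_Dpow 0) (hm _ hZ) (bounded_sigma t hZ)) Dpow0_smul.
    by rewrite /sadd sigmaE.
  rewrite !split1 // /d.
  have -> : smul (minus1 X') (sigma lnq t X') g = smul (minus1 X) (sigma lnq t X) g.
    apply: (smul_agree (a := -1) (b := -1) (k := k)).
    + exact: (hm _ hX').1.
    + exact: (hm _ hX).1.
    + exact: degree_le_sigma hX'.1.
    + exact: degree_le_sigma hX.1.
    + rewrite -eqk => x nx; rewrite /minus1 /sadd.
      by rewrite (sexp_agree t hX hX' XX' nx).
    + by rewrite -eqk; apply: agree_sigma; exact: agree_sym.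
    + move=> h; have : below (0 - k.+2%:R) (0 - k.+1%:R).
        move: h; congr below; last by rewrite /g sub0r.
        by rewrite -[k.+2]addn2 natrD; ring.
      by move=> /belowB; rewrite ltnn.
  by rewrite mulrBr; ring.
- by rewrite !sexp0 subrr /phi prim0 mul0r.
Qed.

(** Newton iteration for exp a(X + ln D) = L.  The residual L D^-a - A_X(a),
    divided by the factors phi, corrects X; the error loses one degree at each
    step by [sexp_linear]. *)
Fixpoint newton (a : C) (L : symbol) (k : nat) : symbol :=
  if k is k'.+1 then fun g n => newton a L k' g n +
    (phi n a)^-1 * (smul L (Dpow (- a)) g n - sexp (newton a L k') a g n)
  else @symb0 R.

(** The logarithm X of L = exp a(X + ln D): the coefficient of D^-k is final
    after k steps. *)
Definition slog (a : C) (L : symbol) : symbol := fun g => newton a L (depth g) g.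

Lemma regular_bounded t0 a A s : regular t0 a A -> bounded a (A t0 s).
Proof.
move=> /regular_slice h; apply: (ubounded_at _ (h _ (nbhs_filter (s : C^o)))).
by move=> P; exact: nbhs_singleton.
Qed.

Lemma regular_eval t0 a A s : regular t0 a A -> regular t0 a (fun t _ => A t s).
Proof.
move=> [[hA [S [hS AS]]] sA]; split; last first.
  move=> g n; have [F' hF] := sep_derive (sA g n).
  exact: sep_param (hF s).1.
split; first by apply: (@filterS _ (nbhsC t0) _ _ _ _ hA) => t h s'; exact: (h s).
by exists S; split=> // g; apply: (@filterS _ (nbhsC t0) _ _ _ _ (AS g)) => t h s'; exact: (h s).
Qed.

Lemma regular_lead0 t0 a A : regular t0 a A ->
  (\forall t \near (t0 : C^o), forall s, A t s a = (fun=> 0)) ->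
  regular t0 (a - 1) A.
Proof.
move=> [[hA [S [hS AS]]] sA] A0; split=> //.
have sub g : below a g -> g <> a -> below (a - 1) g.
  move=> [[|i] ->]; first by rewrite subr0.
  by move=> _; exists i; rewrite -[i.+1]add1n natrD; ring.
split.
  apply: (@filterS2 _ (nbhsC t0) _ _ _ _ _ hA A0) => t h h0 s g n hg.
  apply: (sub _ (h s _ _ hg)) => ga; move: hg.
  by rewrite /= ga h0 eqxx.
exists (fun g n => S g n /\ g <> a); split.
  split=> [g n [/hS.1 h1 h2]|g]; first exact: sub.
  by have [N hN] := hS.2 g; exists N => n [/hN].
move=> g; apply: (@filterS2 _ (nbhsC t0) _ _ _ _ _ (AS g) A0) => t h h0 s n hg.
split; first exact: h hg.
by move=> ga; move: hg; rewrite /= ga h0 eqxx.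
Qed.

Lemma regular_scale t0 a A (c : int -> C) : regular t0 a A ->
  regular t0 a (fun t s g n => c n * A t s g n).
Proof.
move=> [hA sA]; split; last by move=> g n; exact: sepM (sep_cst _ _) (sA _ _).
apply: ubounded_sub hA _; apply: filterE => -[t s] g n /=.
by rewrite mulf_eq0 negb_or => /andP[].
Qed.

Lemma smul_Dpowr_lead a L n : Ghat a L -> smul L (Dpow (- a)) 0 n = (n == 0)%:R.
Proof. by move=> [_ h _]; rewrite smul_DpowrE sub0r opprK. Qed.

(** The correction has degree -1 because both terms of the residual have leading
    coefficient 1. *)
Lemma regular_newton t0 a (L : C -> symbol) k :
  regular t0 a (fun t _ => L t) ->
  (\forall t \near (t0 : C^o), Ghat a (L t)) ->
  regular t0 (-1) (fun t _ => newton a (L t) k).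
Proof.
move=> hL GL; elim: k => [|k IH] /=.
  apply: regular_const; split=> [g n|g]; first by rewrite /symb0 eqxx.
  by exists 0 => n; rewrite /symb0 eqxx.
pose r t (s : C) : symbol := sadd (smul (L t) (Dpow (- a))) (sopp (sexp (newton a (L t) k) a)).
have hr : regular t0 0 r.
  apply: regular_add.
    have := regular_smul hL (regular_const t0 (bounded_Dpow (- a))).
    by rewrite subrr.
  exact: regular_opp (regular_eval a (regular_sexp IH)).
have {}hr : regular t0 (-1) r.
  rewrite -[-1]sub0r; apply: regular_lead0 hr _.
  apply: filterS2 GL (regular_degree IH) => t GLt dN s; apply/funext => n.
  by rewrite /r /sadd /sopp (smul_Dpowr_lead n GLt) (sexp_lead a n dN) subrr.
exact: regular_add IH (regular_scale (fun n => (phi n a)^-1) hr).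
Qed.

Lemma bounded_newton a L k : Ghat a L -> bounded (-1) (newton a L k).
Proof.
move=> GL; have hL : regular 0 a (fun _ _ => L).
  by apply: regular_const; have /Ghat_bounded[] := GL.
have h : regular 0 (-1) (fun _ _ => newton a L k).
  by apply: (regular_newton k hL); exact: near_all.
exact: (regular_bounded 0 h).
Qed.

Lemma below_cases g (k : nat) : ~ below (0 - k.+1%:R) g ->
  g = - k%:R \/ ~ below (0 - k%:R) g.
Proof.
move=> ng; have [[[|i] hg]|] := pselect (below (0 - k%:R) g); last by right.
  by left; rewrite hg subr0 sub0r.
by case: ng; exists i; rewrite hg -[i.+1]add1n -[k.+1]addn1 !natrD; ring.
Qed.

Lemma sexp_newton a L k : generic lnq a -> Ghat a L ->
  agree (0 - k.+1%:R) (sexp (newton a L k) a) (smul L (Dpow (- a))).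
Proof.
move=> ga GL; have hN j := bounded_newton j GL.
have dM : degree_le 0 (smul L (Dpow (- a))).
  have /Ghat_bounded[[hL _] _] := GL.
  by have := degree_le_smul hL (@degree_le_Dpow (- a)); rewrite subrr.
have dS j := @degree_le_sexp _ a (hN j).1.
elim: k => [|k IH] g /below_cases[gE|ng].
- rewrite gE oppr0; apply/funext => n.
  by rewrite (smul_Dpowr_lead n GL) sexp_lead //; exact: (hN 0%N).1.
- by rewrite subr0 in ng; rewrite (degree_le_eq0 (dS 0%N) ng) (degree_le_eq0 dM ng).
- have NN : agree (0 - k.+1%:R) (newton a L k) (newton a L k.+1).
    move=> x nx; apply/funext => n /=.
    by rewrite IH // subrr mulr0 addr0.
  rewrite gE; apply/funext => n.
  have := sexp_linear a n (hN k) (hN k.+1) NN.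
  rewrite /= addrAC subrr add0r mulrA divff ?phi_neq0 // mul1r => /addIr ->.
  by [].
- have NN : agree (0 - k.+1%:R) (newton a L k) (newton a L k.+1).
    move=> x nx; apply/funext => n /=.
    by rewrite IH // subrr mulr0 addr0.
  by rewrite -(sexp_agree a (hN k) (hN k.+1) NN ng) IH.
Qed.

Lemma newton_step a L k : generic lnq a -> Ghat a L ->
  agree (0 - k.+1%:R) (newton a L k) (newton a L k.+1).
Proof.
move=> ga GL g ng; apply/funext => n /=.
by rewrite sexp_newton // subrr mulr0 addr0.
Qed.

Lemma degree_le_m1 X : degree_le (-1) X -> degree_le 0 X.
Proof.
move=> hX g n /hX h; move: (below_weaken 1 h); congr below; ring.
Qed.

Lemma slog_newton a L k : generic lnq a -> Ghat a L ->
  agree (0 - k.+1%:R) (slog a L) (newton a L k).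
Proof.
move=> ga GL; apply: (limit_agree (F := newton a L)) => j.
  by apply: degree_le_m1; exact: (bounded_newton j GL).1.
exact: newton_step.
Qed.

Lemma regular_slog t0 a (L : C -> symbol) :
  regular t0 a (fun t _ => L t) ->
  (\forall t \near (t0 : C^o), Ghat a (L t)) ->
  regular t0 (-1) (fun t _ => slog a (L t)).
Proof.
move=> hL GL; have hN k := regular_newton k hL GL; split; last first.
  by move=> g n; exact: (hN (depth g)).2.
split.
  by apply: filterS GL => t GLt s g n; exact: (bounded_newton _ GLt).1.
have /choice[S hS] : forall k, exists S, bounded_supp (-1) S /\
    forall g, \forall p \near param_filter t0, forall n,
      newton a (L p.1) k g n != 0 -> S g n.
  by move=> k; case: (hN k) => -[_ h] _.
exists (fun g n => S (depth g) g n); split.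
  split=> [g n|g]; first by have [h _] := (hS (depth g)).1; exact: h.
  by have [_ h] := (hS (depth g)).1; exact: h.
by move=> g; exact: (hS (depth g)).2.
Qed.

Lemma bounded_slog a L : Ghat a L -> bounded (-1) (slog a L).
Proof.
move=> GL; split=> [g n|g]; first exact: (bounded_newton _ GL).1.
exact: (bounded_newton (depth g) GL).2.
Qed.

Lemma sexp_slog a L : generic lnq a -> Ghat a L ->
  sexp (slog a L) a = smul L (Dpow (- a)).
Proof.
move=> ga GL; apply/funext => g; have [k ng] := exists_not_below g.
have ng' : ~ below (0 - k.+1%:R) g.
  move=> h; apply: ng; move: (below_weaken 1 h); congr below.
  by rewrite -[k.+1]addn1 natrD; ring.
rewrite -(sexp_newton ga GL ng').
by apply: (sexp_agree a (bounded_slog GL) (bounded_newton k GL) _ ng'); exact: slog_newton.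
Qed.

Lemma sexp_inj a X X' : generic lnq a -> bounded (-1) X -> bounded (-1) X' ->
  sexp X a = sexp X' a -> X = X'.
Proof.
move=> ga hX hX' e.
have XX' k : agree (0 - k.+1%:R) X X'.
  elim: k => [|k IH] g ng.
    rewrite sub0r in ng.
    by rewrite (degree_le_eq0 hX.1 ng) (degree_le_eq0 hX'.1 ng).
  have [gE|ng'] := below_cases ng; last exact: IH.
  apply/funext => n; have := sexp_linear a n hX hX' IH.
  rewrite e subrr => /esym/eqP; rewrite mulf_eq0 (negPf (phi_neq0 n ga)) /=.
  by rewrite subr_eq0 gE => /eqP.
apply/funext => g; have [k ng] := exists_not_below g; apply: (XX' k) => h.
apply: ng; move: (below_weaken 1 h); congr below.
by rewrite -[k.+1]addn1 natrD; ring.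
Qed.

Lemma qexpE X t : bounded (-1) X -> qexp lnq X t = smul (sexp X t) (Dpow t).
Proof. by move=> hX; rewrite /qexp exp_solE. Qed.

Lemma qexp_slog a L : generic lnq a -> Ghat a L -> qexp lnq (slog a L) a = L.
Proof.
move=> ga GL; rewrite (qexpE _ (bounded_slog GL)) sexp_slog //.
have /Ghat_bounded[hL _] := GL.
by rewrite (smulA hL (bounded_Dpow _) (bounded_Dpow _)) smul_Dpow addNr smul_Dpow0.
Qed.

Lemma qexp_inj a X X' : generic lnq a -> bounded (-1) X -> bounded (-1) X' ->
  qexp lnq X a = qexp lnq X' a -> X = X'.
Proof.
move=> ga hX hX'; rewrite !qexpE // => e; apply: (sexp_inj ga) => //.
apply/funext => g; apply/funext => n.
have := congr1 (fun A : symbol => A (g + a) n) e.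
by rewrite /= !smul_DpowrE addrK.
Qed.

Lemma qlogE a L : generic lnq a -> Ghat a L -> qlog lnq a L = slog a L.
Proof.
move=> ga GL; have hS := bounded_slog GL; apply: xget_unique.
  by split; [apply/bounded_Jminus|exact: qexp_slog].
move=> X [/bounded_Jminus hX eX]; apply: (qexp_inj ga) => //.
by rewrite eX qexp_slog.
Qed.

Lemma qexpD X s t : bounded (-1) X ->
  smul (qexp lnq X s) (qexp lnq X t) = qexp lnq X (s + t).
Proof.
move=> hX; rewrite !qexpE // -sexpD // -smul_Dpow.
have hE u := bounded_sexp u hX; have D := bounded_Dpow.
rewrite (smulA (hE s) (D s) (bounded_smul (hE t) (D t))) -(smulA (D s) (hE t) (D t)).
rewrite /sigma (smulA (hE s) (bounded_smul (bounded_smul (D s) (hE t)) (D (- s))) (bounded_smul (D s) (D t))).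
rewrite (smulA (bounded_smul (D s) (hE t)) (D (- s)) (bounded_smul (D s) (D t))).
by rewrite !smul_Dpow addKr.
Qed.

Lemma Ghat_qexp X s : bounded (-1) X -> Ghat s (qexp lnq X s).
Proof.
move=> hX; rewrite qexpE //; apply/Ghat_bounded; split.
  by rewrite -[X in bounded X]add0r; apply: bounded_smul (bounded_sexp s hX) (bounded_Dpow s).
by move=> n; rewrite smul_DpowrE subrr sexp_lead //; exact: hX.1.
Qed.

(** * Nonnegative and negative parts *)

Definition minus_part (A : symbol) : symbol := sadd A (sopp (plus_part A)).

Lemma plus_part_nat (A : symbol) (i : nat) : plus_part A i%:R = A i%:R.
Proof. by rewrite /plus_part; case: asboolP => // h; case: h; exists i. Qed.

Lemma plus_part_out (A : symbol) g : ~ (exists i : nat, g = i%:R) -> plus_part A g = (fun=> 0).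
Proof. by move=> h; rewrite /plus_part; case: asboolP. Qed.

Lemma plus_part_sub (A : symbol) g n : plus_part A g n != 0 -> A g n != 0.
Proof. by rewrite /plus_part; case: asboolP => // _; rewrite eqxx. Qed.

Lemma bounded_plus a A : bounded a A -> bounded a (plus_part A).
Proof. by move=> hA; apply: (bounded_sub hA) => g n; exact: plus_part_sub. Qed.

Lemma bounded_minus (m : nat) A : bounded m%:R A -> bounded (-1) (minus_part A).
Proof.
move=> hA; have h0 := bounded_add hA (bounded_opp (bounded_plus hA)).
split; last exact: h0.2.
move=> g n h; have [i gi] := h0.1 g n h; move: h.
have [im|mi] := leqP i m.
  have -> : g = (m - i)%:R by rewrite gi natrB.
  by rewrite /minus_part /sadd /sopp plus_part_nat subrr eqxx.
move=> _; exists (i - m.+1)%N; rewrite gi natrB // -[m.+1]addn1 natrD; ring.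
Qed.

Lemma plus_minus (A : symbol) : sadd (plus_part A) (minus_part A) = A.
Proof. by apply/funext => g; apply/funext => n; rewrite /minus_part /sadd /sopp subrKC. Qed.

Lemma plus_part_add (A B : symbol) : plus_part (sadd A B) = sadd (plus_part A) (plus_part B).
Proof.
apply/funext => g; rewrite /plus_part /sadd; case: asboolP => // _.
by apply/funext => n; rewrite addr0.
Qed.

Lemma plus_part_opp (A : symbol) : plus_part (sopp A) = sopp (plus_part A).
Proof.
apply/funext => g; rewrite /plus_part /sopp; case: asboolP => // _.
by apply/funext => n; rewrite oppr0.
Qed.

Lemma plus_part_neg (k : nat) A : bounded (- k.+1%:R) A -> plus_part A = @symb0 R.
Proof.
move=> hA; apply/funext => g; apply/funext => n; rewrite /symb0.
apply/eqP; apply/negP => /negP h.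
have [i gi] := hA.1 g n (plus_part_sub h).
have [[j gj]|ng] := pselect (exists j : nat, g = j%:R); last first.
  by move: h; rewrite plus_part_out // eqxx.
have : (j + (i + k.+1))%:R = 0 :> C by rewrite !natrD -gj gi; ring.
by move=> /eqP; rewrite pnatr_eq0 !addnS.
Qed.

Lemma plus_part_id (A : symbol) : (forall g n, A g n != 0 -> exists i : nat, g = i%:R) ->
  plus_part A = A.
Proof.
move=> hA; apply/funext => g; rewrite /plus_part; case: asboolP => // ng.
apply/funext => n; apply/esym/eqP; apply/negP => /negP h.
exact/ng/(hA g n).
Qed.

Lemma plus_part_scomm A B :
  plus_part (scomm lnq (plus_part A) (plus_part B)) =
  scomm lnq (plus_part A) (plus_part B).
Proof.
have nn (A' B' : symbol) g n : smul (plus_part A') (plus_part B') g n != 0 ->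
    exists i : nat, g = i%:R.
  move=> /smul_neq0[b [i [A0 B0]]].
  have nat_of (D : symbol) x m : plus_part D x m != 0 -> exists i : nat, x = i%:R.
    by rewrite /plus_part; case: asboolP => // _; rewrite eqxx.
  have [j1 h1] := nat_of _ _ _ A0; have [j2 h2] := nat_of _ _ _ B0.
  by exists (j1 + j2)%N; rewrite natrD -h1 -h2 subrKC.
apply: plus_part_id => g n; rewrite /scomm /sadd /sopp => h.
have [e|/nn//] := eqVneq (smul (plus_part A) (plus_part B) g n) 0.
by move: h; rewrite e sub0r oppr_eq0 => /nn.
Qed.

(** * Powers of L along a Lax equation *)

(** f vanishes at all a/N, so its derivative at 0 is zero; then
    f(s) = N f(s/N) = o(1).  Complex differentiability is essential: there are
    continuous additive maps of C, real-linear ones, that vanish at a. *)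
Lemma additive_zero (f : C -> C) (a d : C) : (forall s r, f (s + r) = f s + f r) ->
  cder f 0 d -> f a = 0 -> a != 0 -> forall s, f s = 0.
Proof.
move=> fD df fa a0.
have f0 : f 0 = 0 by have := fD 0 0; rewrite addr0 => /eqP; rewrite -subr_eq0 opprD addNKr oppr_eq0 => /eqP.
have fn x (N : nat) : f (x *+ N) = f x *+ N.
  by elim: N => [|N IH]; rewrite ?mulr0n // !mulrS fD IH.
have fdiv x (N : nat) : f (x / N.+1%:R) = f x / N.+1%:R.
  apply: (mulIf (x := N.+1%:R)); first by rewrite pnatr_eq0.
  rewrite [RHS]divfK ?pnatr_eq0 // mulr_natr -fn; congr f.
  by rewrite -[LHS]mulr_natr divfK ?pnatr_eq0.
have lin x e : 0 < e -> `|f x - x * d| <= e * `|x|.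
  move=> e0; move/is_deriveP_eps: df => /(_ e e0)/near0_complexP[r r0 H].
  have [N hN] : exists N : nat, `|x / N.+1%:R| < r%:C.
    have x0 : `|x| = (complex.Re `|x|)%:C by rewrite normc_def.
    exists (Num.truncn (complex.Re `|x| / r)).
    rewrite normrM normfV normr_nat ltr_pdivrMr ?ltr0n // x0.
    rewrite -(rmorph_nat (real_complex R)) -rmorphM ltcR /= mulrC -ltr_pdivrMr //.
    by rewrite truncnS_gt.
  have := H _ hN; rewrite add0r f0 subr0 fdiv mulrAC -mulrBl.
  by rewrite !normrM mulrA ler_pM2r // normfV invr_gt0 normr_nat ltr0n.
have lim0 (x y : C) : (forall e, 0 < e -> `|x| <= e * `|y|) -> x = 0.
  move=> h; have [//|] := eqVneq x 0; rewrite -normr_gt0 => x0.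
  have y1 : 0 < `|y| + 1 by rewrite ltr_wpDl.
  have := h _ (divr_gt0 x0 y1).
  by rewrite mulrAC ler_pdivlMr // ler_pM2l // gerDl ler10.
have d0 : d = 0.
  have : a * d = 0.
    by apply: (lim0 _ a) => e e0; have := lin a e e0; rewrite fa sub0r normrN.
  by move=> /eqP; rewrite mulf_eq0 (negPf a0) => /eqP.
move=> s; apply: (lim0 _ s) => e e0.
by have := lin s e e0; rewrite d0 mulr0 subr0.
Qed.

Local Notation E X := (qexp lnq X).

Lemma bounded_qexp X s : bounded (-1) X -> bounded s (E X s).
Proof. by move=> /(Ghat_qexp s)/Ghat_bounded[]. Qed.

(** Induction on the degree of F.  As E_s = D^s + lower terms, the top coefficient
    satisfies f_(s+r) = f_s + h^s f_r.  Exchanging s and r, with r = a, gives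
    f_s = q^(an) f_s on the coefficient of z^n, which is therefore zero if n <> 0;
    the coefficient of z^0 is additive in s and [additive_zero] applies. *)
Lemma cocycle_zero a X (F : C -> symbol) : generic lnq a -> bounded (-1) X ->
  (forall s, bounded s (F s)) ->
  (forall s r, F (s + r) = sadd (smul (F s) (E X r)) (smul (E X s) (F r))) ->
  F a = @symb0 R ->
  (forall k : nat, exists d, cder (fun s => F s (s - k%:R) 0) 0 d) ->
  forall s, F s = @symb0 R.
Proof.
move=> ga hX hF FD Fa dF.
suff : forall (k : nat) s g, ~ below (s - k%:R) g -> F s g = (fun=> 0).
  move=> h s; apply/funext => g.
  have [[k gk]|nb] := pselect (below s g); last by apply: (h 0%N); rewrite subr0.
  by apply: (h k.+1 s g); rewrite gk => /belowB; rewrite ltnn.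
elim=> [|k IH] s g ng; first by rewrite subr0 in ng; exact: degree_le_eq0 (hF s).1 ng.
have dFk u : degree_le (u - k%:R) (F u).
  by move=> x m; apply: contraPP => nx; rewrite IH // eqxx.
have not_low (u : C) : ~ below (u - 1 - k%:R) (u - k%:R).
  move=> h; have : below (u - k.+1%:R) (u - k%:R).
    by move: h; congr below; rewrite -[k.+1]addn1 natrD; ring.
  by move=> /belowB; rewrite ltnn.
have Hm u : bounded (u - 1) (sadd (E X u) (sopp (Dpow u))).
  exact/Ghat_subDpow/Ghat_qexp.
have Esplit u : E X u = sadd (Dpow u) (sadd (E X u) (sopp (Dpow u))).
  by apply/funext => x; apply/funext => m; rewrite /sadd /sopp subrKC.
have [f [fE fD]] : exists f : C -> int -> C,
    (forall u n, f u n = F u (u - k%:R) n) /\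
    forall u r n, f (u + r) n = f u n + qpow u ^ n * f r n.
  exists (fun u n => F u (u - k%:R) n); split=> // u r n.
  rewrite FD [in LHS]/sadd; congr (_ + _).
    rewrite (Esplit r) (smulDr (hF u) (bounded_Dpow r) (Hm r)) /sadd smul_DpowrE.
    rewrite -/(sadd (E X r) (sopp (Dpow r))) [X in _ + X](_ : _ = 0).
      by rewrite addr0; congr (F u _ n); ring.
    rewrite (degree_le_eq0 (degree_le_smul (dFk u) (Hm r).1)) //.
    by move=> h; apply: (not_low (u + r)); move: h; congr below; ring.
  rewrite (Esplit u) (smulDl (bounded_Dpow u) (Hm u) (hF r)) /sadd smul_DpowlE.
  rewrite -/(sadd (E X u) (sopp (Dpow u))) [X in _ + X](_ : _ = 0).
    by rewrite addr0; congr (_ * F r _ n); ring.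
  rewrite (degree_le_eq0 (degree_le_smul (Hm u).1 (dFk r))) //.
  by move=> h; apply: (not_low (u + r)); move: h; congr below; ring.
have fa n : f a n = 0 by rewrite fE Fa.
have f0 u n : f u n = 0.
  have [->|n0] := eqVneq n 0.
    have [d df] := dF k.
    have fk : (fun s => f s 0) = (fun s => F s (s - k%:R) 0).
      by apply/funext => x; rewrite fE.
    rewrite -fk in df.
    apply: (additive_zero (f := fun s => f s 0) (a := a) (d := d)) => //.
      by move=> x y; rewrite fD expr0z mul1r.
    by have := generic_neq0 ga; rewrite mulf_eq0 negb_or => /andP[].
  (* f (u + a) computed in two ways, with f a = 0 *)
  have h : f u n = qpow a ^ n * f u n.
    have := fD a u n; rewrite [a + u]addrC (fD u a n) (fa n).
    by move: (qpow u ^ n) (qpow a ^ n) (f u n) => x y z; rewrite mulr0 addr0 add0r.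
  have : (1 - qpow a ^ n) * f u n = 0 by rewrite mulrBl mul1r -h; exact: subrr.
  move/eqP; rewrite mulf_eq0 subr_eq0 eq_sym (negPf (generic_qpow ga n0)) /=.
  by move/eqP.
have [nb|nb] := pselect (below (s - k%:R) g); last exact: IH.
case: nb => -[|i] gi.
  by apply/funext => n; have := f0 s n; rewrite fE gi subr0.
by case: ng; exists i; rewrite gi -[i.+1]add1n -[k.+1]addn1 !natrD; ring.
Qed.

Lemma scomm_qexp X s r : bounded (-1) X -> scomm lnq (E X s) (E X r) = @symb0 R.
Proof.
move=> hX; rewrite /scomm !qexpD // addrC.
by apply/funext => g; apply/funext => n; rewrite /sadd /sopp subrr.
Qed.

(** E_m commutes with E_s.  The right-hand side shows that the commutator has
    degree s - 1, the left-hand side that it is the Lax equation. *)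
Lemma plus_scomm_qexp X (m : nat) s : bounded (-1) X ->
  scomm lnq (plus_part (E X m%:R)) (E X s) =
  sopp (scomm lnq (minus_part (E X m%:R)) (E X s)).
Proof.
move=> hX; have hE u := bounded_qexp u hX.
have := scomm_qexp m%:R s hX.
rewrite -{1}(plus_minus (E X m%:R)).
rewrite (scommDl (bounded_plus (hE _)) (bounded_minus (hE _)) (hE s)) => h.
apply/funext => g; apply/funext => n; apply/eqP; rewrite -addr_eq0; apply/eqP.
exact: (congr1 (fun A : symbol => A g n) h).
Qed.

Lemma bounded_plus_scomm X (m : nat) s : bounded (-1) X ->
  bounded (-1 + s) (scomm lnq (plus_part (E X m%:R)) (E X s)).
Proof.
move=> hX; rewrite plus_scomm_qexp //; apply: bounded_opp.
exact: bounded_scomm (bounded_minus (bounded_qexp _ hX)) (bounded_qexp s hX).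
Qed.

(** [P, E_s] = (P A(s) - A(s) sigma_s(P)) D^s, and the first factor has a degree
    that does not move with s. *)
Lemma cder_coef_scomm P b X (k : nat) : bounded b P -> bounded (-1) X ->
  exists d, cder (fun s => scomm lnq P (E X s) (s - k%:R) 0) 0 d.
Proof.
move=> hP hX.
pose D (f : C -> C) := exists d, cder f 0 d.
have Dc x : D (fun=> x) by exists 0; exact: cder_cst.
have DD f g : D f -> D g -> D (fun t => f t + g t).
  by move=> [d hd] [e he]; exists (d + e); exact: cderD.
have DM f g : D f -> D g -> D (fun t => f t * g t).
  by move=> [d hd] [e he]; eexists; exact: cderM hd he.
have Dn f g : D f -> (\forall t \near nbhsC 0, f t = g t) -> D g.
  by move=> [d hd] fg; exists d; exact: cder_near hd.
have hS := ubounded_sexp hX (nbhs_filter (0 : C^o)).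
have hPc := bounded_ubounded (nbhs_filter (0 : C^o)) hP.
have DS g n : D (fun s => sexp X s g n) by eexists; exact: (sderive_sexp 0 hX g n).
have hSP : ubounded (nbhsC 0) b (fun s => sigma lnq s P).
  apply: (ubounded_sub _ hPc); apply: filterE => u g n.
  by rewrite sigmaE mulf_eq0 negb_or => /andP[].
have DP g n : D (fun s => sigma lnq s P g n).
  under eq_fun do rewrite sigmaE qpow_expz.
  apply: DM (Dc _); eexists; exact: cder_exp.
have C1 := smul_closed _ Dc DD DM Dn hPc hS (fun g n => Dc _) DS (- k%:R) 0.
have C2 := smul_closed _ Dc DD DM Dn hS hSP DS DP (- k%:R) 0.
have [d1 h1] := C1; have [d2 h2] := C2.
exists (d1 - d2); apply: (cder_near _ (cderB h1 h2)).
apply: near_all => s; rewrite /scomm /sadd /sopp qexpE //.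
have hs := bounded_sexp s hX; have Ds := bounded_Dpow s.
rewrite -(smulA hP hs Ds) smul_DpowrE (smulA hs Ds hP).
have -> : smul (Dpow s) P = smul (sigma lnq s P) (Dpow s).
by apply/funext => g; apply/funext => n; rewrite smul_DpowlE smul_DpowrE sigmaE.
rewrite -(smulA hs (bounded_sigma s hP) Ds) smul_DpowrE.
by rewrite addrAC subrr add0r.
Qed.

Lemma regular_ubounded t0 a (A : C -> symbol) : regular t0 a (fun t _ => A t) ->
  ubounded (nbhsC t0) a A.
Proof.
move=> [[hA [S [hS AS]]] _]; split.
  by apply: (@filterS _ (nbhsC t0) _ _ _ _ hA) => t /(_ 0).
by exists S; split=> // g; apply: (@filterS _ (nbhsC t0) _ _ _ _ (AS g)) => t /(_ 0).
Qed.

Lemma ubounded_near (T : Type) (F : set_system T) (FF : Filter F) a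
    (A B : T -> symbol) :
  (\forall t \near F, A t = B t) -> ubounded F a A -> ubounded F a B.
Proof. by move=> AB hA; apply: (ubounded_sub _ hA); apply: filterS AB => t ->. Qed.

Section Family.
Variables (t0 : C) (X : C -> symbol).
Hypothesis regX : regular t0 (-1) (fun t _ => X t).
Hypothesis bX : \forall t \near (t0 : C^o), bounded (-1) (X t).

Let bX0 : bounded (-1) (X t0).
Proof. exact: nbhs_singleton bX. Qed.

Lemma ubounded_qexp s : ubounded (nbhsC t0) s (fun t => E (X t) s).
Proof.
apply: (@ubounded_near _ _ _ _ (fun t => smul (sexp (X t) s) (Dpow s))).
  by apply: filterS bX => t hX; rewrite qexpE.
apply: regular_ubounded; rewrite -[X in regular _ X]add0r.
exact: regular_smul (regular_eval s (regular_sexp regX)) (regular_const t0 (bounded_Dpow s)).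
Qed.

Lemma sderive_qexp_ex : exists dE : C -> symbol,
  (forall s, sderive (fun t => E (X t) s) t0 (dE s)) /\
  forall k : nat, exists d, cder (fun s => dE s (s - k%:R) 0) 0 d.
Proof.
have [_ sX] := regular_sexp regX.
have /choice[D hD] : forall p : C * int, exists D : C -> C, forall s,
    cder (fun t => sexp (X t) s p.1 p.2) t0 (D s) /\ exists d, cder D s d.
  by move=> [g n]; exact: sep_derive (sX g n).
exists (fun s g n => D (g - s, n) s); split.
  move=> s g n; apply: (cder_near _ (hD (g - s, n) s).1).
  by apply: filterS bX => t hX; rewrite qexpE // smul_DpowrE.
move=> k; have [d hd] := (hD (- k%:R, 0) 0).2; exists d.
apply: (cder_near _ hd); apply: near_all => s.
by rewrite addrAC subrr add0r.
Qed.

(** The Lax equation for E_a implies the one for all powers E_s: the defect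
    E_s' - [P, E_s] satisfies the hypotheses of [cocycle_zero]. *)
Lemma sderive_qexp a b P : generic lnq a -> bounded b P ->
  (forall s, bounded s (scomm lnq P (E (X t0) s))) ->
  sderive (fun t => E (X t) a) t0 (scomm lnq P (E (X t0) a)) ->
  forall s, sderive (fun t => E (X t) s) t0 (scomm lnq P (E (X t0) s)).
Proof.
move=> ga hP hPE dEa.
have [dE [hdE cdE]] := sderive_qexp_ex.
have hE s := bounded_qexp s bX0.
have hd s : bounded s (dE s) := bounded_sderive (ubounded_qexp s) (hdE s).
pose F s := sadd (dE s) (sopp (scomm lnq P (E (X t0) s))).
suff F0 : forall s, F s = @symb0 R.
  move=> s; have -> : scomm lnq P (E (X t0) s) = dE s; last exact: hdE.
  apply/funext => g; apply/funext => n; apply/esym/eqP; rewrite -subr_eq0; apply/eqP.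
  exact: (congr1 (fun A : symbol => A g n) (F0 s)).
apply: (cocycle_zero ga bX0).
- by move=> s; exact: bounded_add (hd s) (bounded_opp (hPE s)).
- move=> s r.
  have dD : dE (s + r) = sadd (smul (dE s) (E (X t0) r)) (smul (E (X t0) s) (dE r)).
    apply: sderive_unique (hdE (s + r)) _.
    have h := sderive_smul (ubounded_qexp s) (ubounded_qexp r) (hdE s) (hdE r).
    apply: (sderive_near _ h).
    by apply: filterS bX => t hX; rewrite qexpD.
  rewrite /F dD -(qexpD s r bX0) (scomm_smulr hP (hE s) (hE r)).
  rewrite (smulDl (hd s) (bounded_opp (hPE s)) (hE r)).
  rewrite (smulDr (hE s) (hd r) (bounded_opp (hPE r))).
  rewrite (smulNl (hPE s) (hE r)) (smulNr (hE s) (hPE r)).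
  by apply/funext => g; apply/funext => n; rewrite /sadd /sopp; ring.
- rewrite /F; have -> : dE a = scomm lnq P (E (X t0) a) by exact: sderive_unique (hdE a) dEa.
  by apply/funext => g; apply/funext => n; rewrite /sadd /sopp subrr.
- move=> k; have [d hd'] := cdE k; have [e he] := cder_coef_scomm k hP bX0.
  exists (d - e); exact: cderB hd' he.
Qed.

End Family.

(** * Traces and mixed derivatives *)

(** The substitution (b, i) -> (-b, -i) of the index exchanges the two sums, and
    the factor q^(-bi) is invariant under it. *)
Lemma trace_scomm a b A B : bounded a A -> bounded b B ->
  Tr (scomm lnq A B) = 0.
Proof.
move=> hA hB; rewrite /Tr /scomm /sadd /sopp.
have [ps [ups hps]] := supp_finite hA hB 0 0.
have uqs : uniq [seq (- p.1, - p.2) | p <- ps].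
  rewrite map_inj_uniq // => -[u1 u2] [v1 v2] /= [/oppr_inj -> /oppr_inj ->] //.
rewrite (smul_finite ups) // (smul_finite uqs); last first.
  move=> b' i B0 A0; apply/mapP; exists (- b', - i); rewrite /= ?opprK //.
  by move: A0; rewrite !sub0r => A0; apply: hps => //; rewrite !sub0r !opprK.
rewrite big_map; apply/eqP; rewrite subr_eq0; apply/eqP; apply: eq_bigr => -[x i] _.
rewrite /smul_term /= !sub0r !opprK.
have -> : qpow (- x) ^ i = qpow x ^ (- i).
  by rewrite !qpow_expz; congr cexp; rewrite mulrNz !mulrN mulNr.
by rewrite mulrCA [RHS]mulrCA [A x i * _]mulrC.
Qed.

Lemma sderive_plus (A : C -> symbol) t0 V : sderive A t0 V ->
  sderive (fun t => plus_part (A t)) t0 (plus_part V).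
Proof.
move=> dA g n; rewrite /plus_part; case: asboolP => _; last exact: cder_cst.
exact: dA.
Qed.

Lemma ubounded_plus (T : Type) (F : set_system T) (FF : Filter F) a
    (A : T -> symbol) : ubounded F a A -> ubounded F a (fun t => plus_part (A t)).
Proof.
move=> hA; apply: (ubounded_sub _ hA); apply: filterE => t g n; exact: plus_part_sub.
Qed.

Lemma scommDr a b c A B B' : bounded a A -> bounded b B -> bounded c B' ->
  scomm lnq A (sadd B B') = sadd (scomm lnq A B) (scomm lnq A B').
Proof.
move=> hA hB hB'; rewrite scommC (scommDl hB hB' hA).
rewrite [scomm lnq A B]scommC [scomm lnq A B']scommC.
by apply/funext => g; apply/funext => n; rewrite /sadd /sopp opprD.
Qed.

Lemma scommNl a b A B : bounded a A -> bounded b B ->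
  scomm lnq (sopp A) B = sopp (scomm lnq A B).
Proof.
move=> hA hB; rewrite /scomm (smulNl hA hB) (smulNr hB hA).
by apply/funext => g; apply/funext => n; rewrite /sadd /sopp opprD.
Qed.

Lemma scomm_split a c P N Q M : bounded a P -> bounded a N ->
  bounded c Q -> bounded c M -> scomm lnq (sadd P N) (sadd Q M) = @symb0 R ->
  sadd (scomm lnq P (sadd Q M)) (sopp (scomm lnq Q (sadd P N))) =
  sadd (scomm lnq P Q) (sopp (scomm lnq N M)).
Proof.
move=> hP hN hQ hM.
rewrite (scommDl hP hN (bounded_add hQ hM)) (scommDr hP hQ hM) (scommDr hN hQ hM).
rewrite (scommDr hQ hP hN) [scomm lnq Q P]scommC [scomm lnq Q N]scommC => h.
apply/funext => g; apply/funext => n; move: (congr1 (fun A : symbol => A g n) h).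
rewrite /sadd /sopp /symb0.
move: (scomm _ P Q g n) (scomm _ P M g n) (scomm _ N Q g n) (scomm _ N M g n).
move=> x y z w hh; have -> : w = - (x + y + z) by apply/eqP; rewrite -addr_eq0 -hh; apply/eqP; ring.
by ring.
Qed.

(** Write A = P + N and B = Q + M with P, Q the nonnegative parts.  As [A, B] = 0,
    [P, B] - [Q, A] = [P, Q] - [N, M] by [scomm_split], and [N, M] has only
    negative degrees; so [P, B]_+ - [Q, A]_+ = [P, Q].  The Jacobi identity
    for P, Q, L concludes. *)
Lemma zero_curvature (m k : nat) a A B L : bounded m%:R A -> bounded k%:R B ->
  bounded a L -> scomm lnq A B = @symb0 R ->
  sadd (scomm lnq (plus_part (scomm lnq (plus_part A) B)) L)
       (scomm lnq (plus_part B) (scomm lnq (plus_part A) L)) =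
  sadd (scomm lnq (plus_part (scomm lnq (plus_part B) A)) L)
       (scomm lnq (plus_part A) (scomm lnq (plus_part B) L)).
Proof.
move=> hA hB hL AB0.
have hPA := bounded_plus hA; have hPB := bounded_plus hB.
have hQ := bounded_plus (bounded_scomm hPA hB).
have hQ' := bounded_plus (bounded_scomm hPB hA).
have key : sadd (plus_part (scomm lnq (plus_part A) B))
    (sopp (plus_part (scomm lnq (plus_part B) A))) =
    scomm lnq (plus_part A) (plus_part B).
  have hMA := bounded_add hA (bounded_opp hPA).
  have hMB := bounded_add hB (bounded_opp hPB).
  have := scomm_split hPA hMA hPB hMB.
  rewrite -/(minus_part A) -/(minus_part B) !plus_minus => /(_ AB0).
  move=> /(congr1 (@plus_part R)).
  rewrite plus_part_add plus_part_opp => ->.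
  rewrite plus_part_add plus_part_opp plus_part_scomm.
  have -> : plus_part (scomm lnq (minus_part A) (minus_part B)) = @symb0 R.
    apply: (@plus_part_neg 1); have := bounded_scomm (bounded_minus hA) (bounded_minus hB).
    by congr bounded; rewrite -[2%:R]/(1 + 1) opprD.
  by apply/funext => g; apply/funext => n; rewrite /sadd /sopp /symb0 subr0.
have := scomm_scomm hPA hPB hL.
rewrite -key (scommDl hQ (bounded_opp hQ') hL) (scommNl hQ' hL) => jac.
apply/funext => g; apply/funext => n.
have := congr1 (fun D : symbol => D g n) jac; rewrite /sadd /sopp.
move: (scomm _ (plus_part A) (scomm _ _ _) g n) (scomm _ (plus_part B) (scomm _ _ _) g n) => x y.
move: (scomm _ _ L g n) (scomm _ _ L g n) => z w h.
have -> : w = x - y + z by rewrite h; ring.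
by ring.
Qed.

(** * The hierarchy along a curve *)

(** Differentiability at t0 and the locally uniform bounds are all that is
    asked of a regular family without s-dependence. *)
Lemma regular_curve a (L : C -> symbol) t0 V : curve_at a L t0 ->
  sderive L t0 V -> regular t0 a (fun t _ => L t).
Proof.
move=> [GL bL] dL; apply: regular_param; last by move=> g n; exists (V g n).
have dG : \forall t \near (t0 : C^o), degree_le a (L t).
  by apply: filterS GL => t [].
split=> //; have /choice[N hN] := bL.
exists (fun g n => below a g /\ n <= N g); split.
  by split=> [g n []//|g]; exists (N g) => n [].
move=> g; apply: filterS2 dG (hN g) => t h1 h2 n h; split; first exact: h1 h.
by rewrite leNgt; apply/negP => /h2 e; move: h; rewrite e eqxx.
Qed.

Lemma cpow_qexp a L (k : nat) : generic lnq a -> Ghat a L ->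
  cpow lnq a L (k%:R / a) = E (slog a L) k%:R.
Proof.
move=> ga GL; rewrite /cpow qlogE // mulrC divfK //.
by have := generic_neq0 ga; rewrite mulf_eq0 negb_or => /andP[].
Qed.

Lemma rhs_qexp a L (k : nat) : generic lnq a -> Ghat a L ->
  rhs lnq a k L = scomm lnq (plus_part (E (slog a L) k%:R)) (E (slog a L) a).
Proof. by move=> ga GL; rewrite /rhs cpow_qexp // qexp_slog. Qed.

Lemma bounded_rhs a L (m : nat) : generic lnq a -> Ghat a L ->
  bounded (-1 + a) (rhs lnq a m L).
Proof.
move=> ga GL; rewrite rhs_qexp //; apply: bounded_plus_scomm.
exact: bounded_slog.
Qed.

Lemma sderive_cpow a (L : C -> symbol) (t0 : C) (m : nat) : generic lnq a ->
  curve_at a L t0 -> solves_at lnq a m L t0 ->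
  forall s, sderive (fun t => E (slog a (L t)) s) t0
    (scomm lnq (plus_part (E (slog a (L t0)) m%:R)) (E (slog a (L t0)) s)).
Proof.
move=> ga hL sL; have [GL _] := hL; have GL0 := nbhs_singleton GL.
have regL := regular_curve hL sL.
have regX := regular_slog regL GL.
have bX : \forall t \near (t0 : C^o), bounded (-1) (slog a (L t)).
  by apply: filterS GL => t; exact: bounded_slog.
have bX0 := bounded_slog GL0.
apply: (sderive_qexp regX bX ga (bounded_plus (bounded_qexp m%:R bX0))).
  move=> s; have := bounded_weaken 1 (bounded_plus_scomm m s bX0).
  by congr bounded; ring.
rewrite -(rhs_qexp m ga GL0); apply: (sderive_near _ sL).
by apply: filterS GL => t GLt; rewrite qexp_slog.
Qed.

(** The Leibniz rule for [E_k+, L], the derivatives of both factors being given by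
    the Lax equation for powers. *)
Lemma second_derivative_rhs a (m k : nat) L : generic lnq a -> Ghat a L ->
  second_derivative lnq a m k L
    (sadd (scomm lnq (plus_part (scomm lnq (plus_part (E (slog a L) m%:R)) (E (slog a L) k%:R))) (E (slog a L) a))
          (scomm lnq (plus_part (E (slog a L) k%:R))
             (scomm lnq (plus_part (E (slog a L) m%:R)) (E (slog a L) a)))).
Proof.
move=> ga GL0 F t0 hF F0 sF; have [GF _] := hF.
have dE := sderive_cpow ga hF sF; rewrite -F0.
have regX := regular_slog (regular_curve hF sF) GF.
have bX : \forall t \near (t0 : C^o), bounded (-1) (slog a (F t)).
  by apply: filterS GF => t; exact: bounded_slog.
have uE := ubounded_qexp regX bX.
have := sderive_scomm (ubounded_plus (nbhs_filter (t0 : C^o)) (uE k%:R)) (uE a)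
  (sderive_plus (dE k%:R)) (dE a).
by apply: sderive_near; apply: filterS GF => t GFt; rewrite rhs_qexp.
Qed.

End SymbolAlgebra.

Unset Implicit Arguments.
Set Strict Implicit.
Set Printing Implicit Defensive.

Theorem theorem3p6 (R : realType) (q lnq : R[i])
    (hq : 0 < `|q| < 1) (hlnq : is_log_branch q lnq)
    (alpha : R[i]) (halpha : generic lnq alpha) :
  (* 1: the complex powers, hence the right-hand side, are well defined, and
     the latter is tangent to Ghat_alpha *)
  [/\ (forall X, Jminus X -> exists! A, exp_ode lnq X A) /\
      forall L, Ghat alpha L ->
        (exists! X, Jminus X /\ qexp lnq X alpha = L) /\
        forall m : nat,
          [/\ Ghat m%:R (cpow lnq alpha L (m%:R / alpha)),
              PsiD (cpow lnq alpha L (m%:R / alpha))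
            & tangent lnq alpha (rhs lnq alpha m L)],
  (* 2: the flows commute *)
      forall (m k : nat) L, Ghat alpha L ->
        exists W, second_derivative lnq alpha m k L W /\
                  second_derivative lnq alpha k m L W
  (* 3: the H_k are conserved *)
    & forall (m k : nat), (0 < k)%N ->
        forall (L : R[i] -> symbol) (t0 : R[i]),
          curve_at alpha L t0 -> solves_at lnq alpha m L t0 ->
          @is_derive R[i] R[i]^o R[i]^o t0 1
            (fun t => H lnq alpha k (L t)) 0].
Proof.
split.
- split=> [X /bounded_Jminus hX|L GL].
    exists (sexp lnq X); split; first exact: exp_ode_sexp.
    by move=> A /(exp_ode_unique hX).
  have hX := bounded_slog lnq GL; split.
    exists (slog lnq alpha L); split.
      by split; [apply/bounded_Jminus|exact: qexp_slog].
    move=> Y [/bounded_Jminus hY eY]; apply: (qexp_inj halpha) => //.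
    by rewrite eY qexp_slog.
  move=> m; rewrite cpow_qexp //.
  have GE := Ghat_qexp lnq m%:R hX; split=> //.
    have [lE _ dE] := GE; split=> //; exists m => g n /dE[i ->].
    by exists (m%:Z - i%:Z); split; [lia|rewrite rmorphB].
  have hR := bounded_rhs m halpha GL.
  exists (smul lnq (rhs lnq alpha m L) (Dpow (- alpha))).
    apply/bounded_Jminus; have := bounded_smul lnq hR (bounded_Dpow (- alpha)).
    by rewrite addrK.
  by rewrite (smulA lnq hR (bounded_Dpow _) (bounded_Dpow _)) smul_Dpow addNr smul_Dpow0.
- move=> m k L GL; have hX := bounded_slog lnq GL.
  have hE s := bounded_qexp lnq s hX.
  eexists; split; first exact: second_derivative_rhs.
  rewrite (zero_curvature (hE m%:R) (hE k%:R) (hE alpha)); last exact: scomm_qexp.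
  exact: second_derivative_rhs.
- move=> m k k0 L t0 hL sL; have [GL _] := hL.
  have hX := bounded_slog lnq (nbhs_singleton GL).
  have hE s := bounded_qexp lnq s hX.
  have dE := sderive_cpow halpha hL sL k%:R 0 0.
  rewrite -[0](mulr0 (alpha / k%:R)).
  rewrite -(trace_scomm lnq (bounded_plus (hE m%:R)) (hE k%:R)).
  apply: (cder_near _ (cderZ (alpha / k%:R) dE)).
  by apply: filterS GL => t GLt; rewrite /H /Tr cpow_qexp.
Qed.
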